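(* Let $d\ge 3$ and let $V\colon\mathbb{R}^d\to\mathbb{R}$ be Borel measurable with $V\le 0$. Let $G$ be the fundamental solution of $\partial_t=\Delta+V$. Then there exist numbers $0<c_1\le 1\le c_2<\infty$ such that $$c_1\le\frac{G(t,x,y)}{g(t,x,y)}\le c_2\qquad\text{for all } t>0,\ x,y\in\mathbb{R}^d$$ if and only if the function $(x,y)\mapsto K(V,x,y)$ is bounded on $\mathbb{R}^d\times\mathbb{R}^d$.
   Context: For $x,y\in\mathbb{R}^d$ and $t>0$, $g(t,x,y)=(4\pi t)^{-d/2}e^{-|y-x|^2/(4t)}$. The fundamental solution $G$ of $\partial_t=\Delta+V$ is determined by the Duhamel (perturbation) formula $$G(t,x,y)=g(t,x,y)+\int_0^t\int_{\mathbb{R}^d}G(s,x,z)\,V(z)\,g(t-s,z,y)\,dz\,ds,\qquad t>0,\ x,y\in\mathbb{R}^d.$$ For $d\ge 3$ and $x,y\in\mathbb{R}^d$ (with $x\ne 0$) let $$K(x,y)=\frac{e^{-(|x||y|-x\cdot y)/2}}{|x|^{d-2}}\,(1+|x||y|)^{d/2-3/2},$$ where $x\cdot y$ is the usual scalar product, and $$K(V,x,y)=\int_{\mathbb{R}^d}|V(z)|\,K(z-x,y)\,dz.$$ *)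

(* Defs.v *)
From HB Require Import structures.
From mathcomp Require Import all_boot all_order all_algebra.
From mathcomp Require Import all_classical all_reals all_analysis.

Set Implicit Arguments.
Unset Strict Implicit.
Unset Printing Implicit Defensive.

Import Order.TTheory GRing.Theory Num.Theory.
Import numFieldNormedType.Exports.

Local Open Scope classical_set_scope.
Local Open Scope ring_scope.

(* R^n is [n.-tuple R] with the library's product sigma-algebra, which is the
   Borel sigma-algebra since R is second countable. *)

Section lebesgue_measure_tuple.
Context {R : realType}.

Definition tcons n (p : measurableTypeR R * n.-tuple R) : n.+1.-tuple R :=
  [tuple of p.1 :: p.2].

Lemma measurable_tcons n : measurable_fun [set: _] (@tcons n).
Proof. exact: measurable_cons. Qed.

Section step.
Variables (n : nat) (m : {sigma_finite_measure set (n.-tuple R) -> \bar R}).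

Definition lebesgue_cons : set (n.+1.-tuple R) -> \bar R :=
  pushforward (lebesgue_measure \x m)%E (@tcons n).

Let lebesgue_cons0 : lebesgue_cons set0 = 0%E.
Proof. by rewrite /lebesgue_cons /pushforward preimage_set0 measure0. Qed.

Let lebesgue_cons_ge0 A : (0 <= lebesgue_cons A)%E.
Proof. exact: (@measure_ge0 _ _ _ (lebesgue_measure \x m)%E). Qed.

Let lebesgue_cons_sigma_additive : semi_sigma_additive lebesgue_cons.
Proof.
move=> F mF tF mUF; rewrite /lebesgue_cons /pushforward preimage_bigcup.
apply: measure_semi_sigma_additive.
- by move=> k; rewrite -[X in measurable X]setTI; exact: measurable_tcons.
- apply/trivIsetP => /= i j _ _ ij; rewrite -preimage_setI.
  by move/trivIsetP : tF => /(_ _ _ _ _ ij) ->//; rewrite preimage_set0.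
- by rewrite -preimage_bigcup -[X in measurable X]setTI; exact: measurable_tcons.
Qed.

HB.instance Definition _ := isMeasure.Build _ _ _ lebesgue_cons
  lebesgue_cons0 lebesgue_cons_ge0 lebesgue_cons_sigma_additive.

Lemma lebesgue_consE (A : set R) (B : set (n.-tuple R)) :
  measurable A -> measurable B ->
  lebesgue_cons [set t | A (thead t) /\ B [tuple of behead t]] =
  (lebesgue_measure (A : set (measurableTypeR R)) * m B)%E.
Proof.
move=> mA mB; rewrite -product_measure1E //; congr (product_measure1 _ _ _).
apply/seteqP; split => -[x t] /=; rewrite /tcons theadE /=;
  have -> : [tuple of behead (x :: t)] = t by exact: val_inj.
- by [].
- by [].
Qed.

Let lebesgue_cons_sigma_finite : sigma_finite setT lebesgue_cons.
Proof.
have /sigma_finiteP[G [TG ndG Goo]] := sigma_finiteT m.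
have /sigma_finiteP[F [TF ndF Foo]] := sigma_finiteT (@lebesgue_measure R).
exists (fun k => [set t | F k (thead t) /\ G k [tuple of behead t]]).
  apply/seteqP; split => // t _.
  have [i _ Fi] : (\bigcup_k F k) (thead t) by rewrite -TF.
  have [j _ Gj] : (\bigcup_k G k) [tuple of behead t] by rewrite -TG.
  exists (maxn i j) => //; split.
  - by move: Fi; exact/subsetPset/ndF/leq_maxl.
  - by move: Gj; exact/subsetPset/ndG/leq_maxr.
move=> k; have [mF Fk] := Foo k; have [mG Gk] := Goo k; split.
  apply: (@measurableI _ _ ((fun t : n.+1.-tuple R => thead t) @^-1` (F k))
    ((fun t : n.+1.-tuple R => [tuple of behead t]) @^-1` (G k))).
    rewrite -[X in measurable X]setTI.
    exact: (@measurable_tnth _ R n.+1 ord0).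
  by rewrite -[X in measurable X]setTI; exact: (@measurable_behead _ R n).
by rewrite lebesgue_consE// lte_mul_pinfty// ge0_fin_numE.
Qed.

HB.instance Definition _ := Measure_isSigmaFinite.Build _ _ _ lebesgue_cons
  lebesgue_cons_sigma_finite.

End step.

Fixpoint lebesgue_tuple n : {sigma_finite_measure set (n.-tuple R) -> \bar R} :=
  match n with
  | 0%N => \d_[tuple]
  | n'.+1 => lebesgue_cons (lebesgue_tuple n')
  end.

(* This determines [lebesgue_tuple n]: it is the usual Lebesgue measure. *)
Lemma lebesgue_tuple_box n (A : 'I_n -> set R) :
  (forall i, measurable (A i)) ->
  lebesgue_tuple n [set t | forall i, A i (tnth t i)] =
  (\prod_(i < n) lebesgue_measure (A i : set (measurableTypeR R)))%E.
Proof.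
elim: n A => [|n IHn] A mA.
  rewrite big_ord0 /= diracE mem_set //= => -[] //.
rewrite big_ord_recl -IHn; last by move=> i; exact: mA.
rewrite -lebesgue_consE //; last first.
  rewrite (_ : mkset _ = \bigcap_(i in [set: 'I_n])
      ((fun t : n.-tuple R => tnth t i) @^-1` (A (lift ord0 i)))); last first.
    by apply/seteqP; split => t //= h i; [move=> _; exact: h|exact: h].
  apply: fin_bigcap_measurable => // i _.
  by rewrite -[X in measurable X]setTI; exact: (@measurable_tnth _ R n i).
rewrite /=; congr (lebesgue_cons _ _).
apply/seteqP; split => t /= h.
  split; first exact: h.
  move=> i; have := h (lift ord0 i).
  by rewrite {1}(tuple_eta t) tnthS.
case: h => h0 h i; have [j ->|->] := unliftP ord0 i; last exact: h0.
by rewrite (tuple_eta t) tnthS.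
Qed.

End lebesgue_measure_tuple.

Section heat_kernel.
Context {R : realType} {d : nat}.
Implicit Types (x y z : d.-tuple R) (V : d.-tuple R -> R).

Definition dotr x y : R := \sum_(i < d) tnth x i * tnth y i.

Definition enorm x : R := Num.sqrt (dotr x x).

Definition subt x y : d.-tuple R := [tuple tnth x i - tnth y i | i < d].

Definition gauss (t : R) x y : R :=
  (4 * pi * t) `^ (- (d%:R / 2)) * expR (- (enorm (subt y x) ^+ 2 / (4 * t))).

(* The Duhamel integral is required to converge absolutely, as a Lebesgue
   integral on ]0, t[ x R^d. Nothing is assumed on [G s] for [s <= 0]. *)
Definition fundamental_solution V (G : R -> d.-tuple R -> d.-tuple R -> R) :=
  forall (t : R) x y, 0 < t ->
    (lebesgue_measure \x lebesgue_tuple d)%E.-integrable (`]0, t[ `*` setT)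
      (fun p => (G p.1 x p.2 * V p.2 * gauss (t - p.1) p.2 y)%:E) /\
    ((G t x y)%:E = (gauss t x y)%:E +
      \int[lebesgue_measure]_(s in `]0%R, t[)
        \int[lebesgue_tuple d]_z
          (G s x z * V z * gauss (t - s) z y)%:E)%E.

(* At [x = 0], a null set, this takes the value 0 if [2 < d]. *)
Definition Kker x y : R :=
  expR (- ((enorm x * enorm y - dotr x y) / 2)) / enorm x ^+ (d - 2) *
  (1 + enorm x * enorm y) `^ (d%:R / 2 - 3 / 2).

Definition KV V x y : \bar R :=
  (\int[lebesgue_tuple d]_z (`|V z| * Kker (subt z x) y)%:E)%E.

End heat_kernel.

(* Main.v *)
(* Fix the starting point x and let v = |V|. With the heat potential P, the Duhamel
   formula reads f = g - P(v f), where f = G(., x, .) and g = g(., x, .).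

   If c g <= f, then c P(v g) <= P(v f) <= g. Conversely suppose P(v g) <= c g. A
   domination principle for P gives f >= 0, hence f <= g. For bounded v, f is the value
   of a Brownian motion that survives each point of a Poisson clock of rate l with
   probability 1 - v/l, and Jensen's inequality gives f >= g exp(- 2 P(v g) / g); for
   unbounded v, truncate and pass to the limit. Both arguments are run through the
   resolvent of P, so that no existence or uniqueness theory for G is needed.

   It remains to compare P(v g) / g with K(V, ., .). By the Brownian bridge identity,
   P(v g) / g integrates v(z) against the time integral of the bridge density at z. With
   w = z - x, u = (y - x)/t, a = |w|, b = |u|, the density at time s <= t/2 behaves like
   s^(-d/2) exp(- (a - s b)^2 / (4 s)) exp(- (|w||u| - w.u) / 2), whose time integral is
   of the order of K(w, u): from above by the substitution r = a / sqrt s - b sqrt s,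
   from below by keeping only times near a^2 / (1 + a b). Times s >= t/2 are symmetric. *)

From HB Require Import structures.
Require Import Defs.
From mathcomp Require Import all_boot all_order all_algebra.
From mathcomp Require Import all_classical all_reals all_analysis.
From mathcomp Require Import measurable_realfun ring lra.
Import Order.TTheory GRing.Theory Num.Theory.
Import numFieldNormedType.Exports.
Local Open Scope classical_set_scope.
Local Open Scope ring_scope.

(** * The Gaussian kernel *)

Section gaussian.
Context {R : realType}.

Lemma measurable_sqrtr : measurable_fun [set: R] (@Num.sqrt R).
Proof. by apply: continuous_measurable_fun; exact: sqrt_continuous. Qed.

(** Inversion is discontinuous at 0, so measurability is drawn from the real power of exponent -1 on
    each half-line. *)
Lemma measurable_invr : measurable_fun [set: R] (@GRing.inv R).
Proof.
rewrite (_ : GRing.inv =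
    fun x => if 0 <= x then x `^ (-1) else - (- x) `^ (-1)); last first.
  apply/funext => x; case: leP => x0; first by rewrite powR_inv1.
  by rewrite powR_inv1 ?oppr_ge0 1?ltW// invrN opprK.
apply: measurable_fun_ifT => //; first exact: measurable_fun_ler.
exact: (measurableT_comp (@oppr_measurable R setT)
  (measurableT_comp (@measurable_powR R (-1)) (@oppr_measurable R setT))).
Qed.

Lemma ge0_integral_lebesgue_tupleS n (f : n.+1.-tuple R -> \bar R) :
  measurable_fun setT f -> (forall t, 0 <= f t)%E ->
  (\int[lebesgue_tuple n.+1]_t f t =
   \int[lebesgue_measure]_a \int[lebesgue_tuple n]_t f (tcons (a, t)))%E.
Proof.
move=> mf f0.
transitivity (\int[(lebesgue_measure \x lebesgue_tuple n)%E]_p (f \o @tcons R n) p)%E.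
  exact: (ge0_integral_pushforward (@measurable_tcons R n)).
rewrite fubini_tonelli1//; last by move=> p; exact: f0.
by apply: measurableT_comp => //; exact: measurable_tcons.
Qed.

(** Serves to compute the mass of the Gaussian, whose density factors over the coordinates. *)
Lemma ge0_integral_lebesgue_tuple_prod n (f : 'I_n -> R -> R) :
  (forall i, measurable_fun setT (f i)) -> (forall i a, 0 <= f i a) ->
  (\int[lebesgue_tuple n]_t (\prod_(i < n) f i (tnth t i))%:E =
   \prod_(i < n) \int[lebesgue_measure]_a (f i a)%:E)%E.
Proof.
elim: n f => [|n IH] f mf f0.
  rewrite big_ord0 /=; under eq_integral do rewrite big_ord0.
  by rewrite (integral_cst _ measurableT) mul1e /= diracT.
have mprod m (g : 'I_m -> R -> R) : (forall i, measurable_fun setT (g i)) ->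
    measurable_fun setT (fun t : m.-tuple R => \prod_(i < m) g i (tnth t i)).
  move=> mg; apply: measurable_prod => i _.
  by apply: measurableT_comp => //; exact: measurable_tnth.
rewrite ge0_integral_lebesgue_tupleS; last 2 first.
- by apply/measurable_EFinP; exact: mprod.
- by move=> t; rewrite lee_fin prodr_ge0.
rewrite big_ord_recl -(IH (fun i => f (lift ord0 i)))//.
under eq_integral => a _.
  under eq_integral => t _.
    rewrite big_ord_recl EFinM /=.
    have -> : tnth (tcons (a, t)) ord0 = a by [].
    under eq_bigr do rewrite tnthS.
    over.
  rewrite ge0_integralZl_EFin//=; last 2 first.
  - by move=> t _; rewrite lee_fin prodr_ge0.
  - apply/measurable_EFinP; apply: measurable_prod => i _.
    apply: measurableT_comp => //.
    exact: (@measurable_tnth _ R n i).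
  over.
rewrite ge0_integralZr//=; last 3 first.
- apply/measurable_EFinP; exact: mf.
- by move=> a _; rewrite lee_fin.
- by apply: integral_ge0 => t _; rewrite lee_fin prodr_ge0.
Qed.


Section kernel.
Context {d : nat}.
Implicit Types (x y z : d.-tuple R) (s t : R).

Lemma sqr_enorm x : enorm x ^+ 2 = \sum_(i < d) tnth x i ^+ 2.
Proof. by rewrite sqr_sqrtr // sumr_ge0 // => i _; rewrite -expr2 sqr_ge0. Qed.

Lemma sqr_enorm_subt x y :
  enorm (subt x y) ^+ 2 = \sum_(i < d) (tnth x i - tnth y i) ^+ 2.
Proof. by rewrite sqr_enorm; apply: eq_bigr => i _; rewrite tnth_mktuple. Qed.

Lemma enorm_subtC x y : enorm (subt x y) = enorm (subt y x).
Proof.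
congr Num.sqrt; apply: eq_bigr => i _.
by rewrite !tnth_mktuple -mulrNN !opprB.
Qed.

Lemma enorm_ge0 x : 0 <= enorm x.
Proof. exact: sqrtr_ge0. Qed.

(** Turns the half-integer real powers of the definitions into natural powers of square roots, which
    [ring] and [field] can handle. *)
Lemma powR_half (a : R) n : 0 <= a -> a `^ (n%:R / 2) = Num.sqrt a ^+ n.
Proof. by move=> a0; rewrite mulrC powRrM powR12_sqrt// powR_mulrn// sqrtr_ge0. Qed.

Lemma gaussE t x y : 0 < t -> gauss t x y =
  (Num.sqrt (4 * pi * t))^-1 ^+ d * expR (- (enorm (subt y x) ^+ 2 / (4 * t))).
Proof.
move=> t0; rewrite /gauss powRN powR_half ?exprVn//.
by rewrite !mulr_ge0 ?pi_ge0// ltW.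
Qed.

Lemma gauss_gt0 t x y : 0 < t -> 0 < gauss t x y.
Proof.
move=> t0; rewrite gaussE// mulr_gt0 ?expR_gt0// exprn_gt0// invr_gt0 sqrtr_gt0.
by rewrite !mulr_gt0 ?pi_gt0.
Qed.

Lemma gauss_ge0 t x y : 0 <= gauss t x y.
Proof. by rewrite mulr_ge0 ?powR_ge0 ?expR_ge0. Qed.

Lemma gaussC t x y : gauss t x y = gauss t y x.
Proof. by rewrite /gauss enorm_subtC. Qed.

(** The variance per coordinate is [2 * t] because the generator is the full Laplacian, not half of
    it. *)
Lemma gauss_prod t x y : 0 < t -> gauss t x y =
  \prod_(i < d) normal_pdf (tnth x i) (Num.sqrt (2 * t)) (tnth y i).
Proof.
move=> t0; rewrite gaussE// sqr_enorm_subt.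
have s0 : Num.sqrt (2 * t) != 0 by rewrite gt_eqF// sqrtr_gt0 mulr_gt0.
under [RHS]eq_bigr do rewrite (normal_pdfE _ s0) /normal_peak /normal_fun.
rewrite big_split /= prodr_const card_ord; congr (_ * _).
  congr (_^-1 ^+ _); congr Num.sqrt; rewrite sqr_sqrtr; last by rewrite mulr_ge0// ltW.
  by ring.
rewrite mulr_suml -sumrN expR_sum; apply: eq_bigr => i _; congr expR.
rewrite mulNr; congr (- (_ / _)); rewrite sqr_sqrtr; last by rewrite mulr_ge0// ltW.
by ring.
Qed.

Lemma integral_gauss t x : 0 < t ->
  (\int[lebesgue_tuple d]_y (gauss t x y)%:E = 1)%E.
Proof.
move=> t0; under eq_integral do rewrite gauss_prod//.
rewrite (ge0_integral_lebesgue_tuple_prod d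
  (fun i => normal_pdf (tnth x i) (Num.sqrt (2 * t)))).
- by rewrite big1// => i _; exact: integral_normal_pdf.
- by move=> i; exact: measurable_normal_pdf.
- by move=> i a; exact: normal_pdf_ge0.
Qed.

(** The mean of the Brownian bridge from [x] to [y] at the fraction [a] of its lifetime. *)
Definition segt x y (a : R) : d.-tuple R :=
  [tuple tnth x i + a * (tnth y i - tnth x i) | i < d].

(* Pinning Brownian motion at both ends yields a Brownian bridge. *)
Lemma gauss_bridge s t x y z : 0 < s -> 0 < t ->
  gauss s x z * gauss t z y =
  gauss (s + t) x y * gauss (s * t / (s + t)) (segt x y (s / (s + t))) z.
Proof.
move=> s0 t0; have st0 : 0 < s + t by rewrite addr_gt0.
have r0 : 0 < s * t / (s + t) by rewrite divr_gt0// mulr_gt0.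
have p0 := pi_gt0 R.
rewrite !gaussE// mulrACA [RHS]mulrACA; congr (_ * _).
  rewrite -!exprMn -!invfM -!sqrtrM; last 2 first.
  - by rewrite !mulr_ge0 ?pi_ge0// ltW.
  - by rewrite !mulr_ge0 ?pi_ge0// ltW.
  congr (_^-1 ^+ _); congr Num.sqrt; field.
  by rewrite gt_eqF.
rewrite -!expRD; congr expR.
rewrite (sqr_enorm_subt z x) (sqr_enorm_subt y z) (sqr_enorm_subt y x).
rewrite (sqr_enorm_subt z (segt _ _ _)) !mulr_suml -!sumrN -!big_split/=.
apply: eq_bigr => i _; rewrite tnth_mktuple; field.
by rewrite !gt_eqF.
Qed.

Lemma measurable_enorm d' (T : measurableType d') (f : T -> d.-tuple R) :
  measurable_fun setT f -> measurable_fun setT (fun p => enorm (f p)).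
Proof.
move=> mf; apply: (measurableT_comp measurable_sqrtr (g := fun p => dotr (f p) (f p))).
apply: measurable_sum => i; apply: measurable_funM;
  exact: (measurableT_comp (@measurable_tnth _ R d i) mf).
Qed.

Lemma measurable_subt d' (T : measurableType d') (f g : T -> d.-tuple R) :
  measurable_fun setT f -> measurable_fun setT g ->
  measurable_fun setT (fun p => subt (f p) (g p)).
Proof.
move=> mf mg; apply/measurable_fun_tnthP => i.
rewrite (_ : _ \o _ = fun p => tnth (f p) i - tnth (g p) i); last first.
  by apply/funext => p /=; rewrite tnth_mktuple.
by apply: measurable_funB; exact: (measurableT_comp (@measurable_tnth _ R d i)).
Qed.

Lemma measurable_gauss d' (T : measurableType d') (r : T -> R) (f g : T -> d.-tuple R) :
  measurable_fun setT r -> measurable_fun setT f -> measurable_fun setT g ->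
  measurable_fun setT (fun p => gauss (r p) (f p) (g p)).
Proof.
move=> mr mf mg; apply: measurable_funM.
  apply: (measurableT_comp (@measurable_powR R _)); exact: measurable_funM.
apply: (measurableT_comp (@measurable_expR R)); apply: measurable_funN.
apply: measurable_funM.
  by apply: measurable_funX; apply: measurable_enorm; exact: measurable_subt.
apply: (measurableT_comp (measurable_invr)); exact: measurable_funM.
Qed.

(** By [gauss_bridge] the integrand is [gauss (s + t) x y] times a probability density in [z]. *)
Lemma gauss_chapman_kolmogorov s t x y : 0 < s -> 0 < t ->
  (\int[lebesgue_tuple d]_z (gauss s x z * gauss t z y)%:E =
   (gauss (s + t) x y)%:E)%E.
Proof.
move=> s0 t0; under eq_integral do rewrite gauss_bridge// EFinM.
rewrite ge0_integralZl_EFin//.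
- by rewrite integral_gauss ?mule1// divr_gt0 ?mulr_gt0 ?addr_gt0.
- by move=> z _; rewrite lee_fin gauss_ge0.
- by apply/measurable_EFinP; exact: measurable_gauss.
- exact: gauss_ge0.
Qed.

End kernel.

End gaussian.

(** * Heat potentials and their resolvent *)

(* The library's sigma-finiteness instance on products is shadowed by the one on
   products of subprobabilities, so it is redeclared on a named measure. *)
Definition spacetime {R : realType} (d : nat) :
    set (measurableTypeR R * d.-tuple R) -> \bar R :=
  (lebesgue_measure \x lebesgue_tuple d)%E.

HB.instance Definition _ {R : realType} (d : nat) :=
  Measure.copy (@spacetime R d) (lebesgue_measure \x lebesgue_tuple d)%E.

Lemma spacetime_sigma_finite {R : realType} (d : nat) :
  sigma_finite setT (@spacetime R d).
Proof.
have /sigma_finiteP[F [TF ndF Foo]] := sigma_finiteT (@lebesgue_measure R).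
have /sigma_finiteP[G [TG ndG Goo]] := sigma_finiteT (@lebesgue_tuple R d).
exists (fun k => F k `*` G k) => [|k].
  apply/seteqP; split => // -[s z] _.
  have [i _ Fi] : (\bigcup_k F k) s by rewrite -TF.
  have [j _ Gj] : (\bigcup_k G k) z by rewrite -TG.
  exists (maxn i j) => //; split.
  - by move: (s) Fi; exact/subsetPset/ndF/leq_maxl.
  - by move: (z) Gj; exact/subsetPset/ndG/leq_maxr.
have [mF Fk] := Foo k; have [mG Gk] := Goo k; split; first exact: measurableX.
by rewrite /spacetime product_measure1E// lte_mul_pinfty// ge0_fin_numE.
Qed.

HB.instance Definition _ {R : realType} (d : nat) :=
  Measure_isSigmaFinite.Build _ _ _ (@spacetime R d) (spacetime_sigma_finite d).

Lemma integral_is_derive {R : realType} (F f : R -> R) (a b : R) : a < b ->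
  (forall r, a <= r <= b -> is_derive r 1 F (f r)) ->
  {within `[a, b], continuous f} ->
  (\int[lebesgue_measure]_(r in `[a, b]) (f r)%:E = (F b)%:E - (F a)%:E)%E.
Proof.
move=> ab dF cf.
have cF r : a <= r <= b -> {for r, continuous F}.
  by move=> /dF[df _]; apply: differentiable_continuous; exact/derivable1_diffP.
apply: (continuous_FTC2 ab cf).
  split.
  - by move=> r /[!in_itv]/= /andP[/ltW ar /ltW rb]; move: (dF r); rewrite ar rb => /(_ isT)[].
  - by apply: cvg_at_right_filter; apply: cF; rewrite lexx ltW.
  - by apply: cvg_at_left_filter; apply: cF; rewrite lexx ltW.
move=> r /[!in_itv]/= /andP[/ltW ar /ltW rb].
by rewrite derive1E; move: (dF r); rewrite ar rb => /(_ isT)[].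
Qed.

Section heat_potential.
Context {R : realType} {d : nat}.
Local Notation X := (measurableTypeR R * d.-tuple R)%type.
Local Notation mu := (@spacetime R d).
Implicit Types (l : R) (p q : X) (f g : X -> \bar R).

(** The transition density of Brownian motion killed at rate [l]. Its extension by 0 to
    nonincreasing times makes every potential an integral over all of spacetime. *)
Definition heatk l p q : R :=
  if p.1 < q.1 then expR (- (l * (q.1 - p.1))) * gauss (q.1 - p.1) p.2 q.2 else 0.

Definition heatpot l f q : \bar R := (\int[mu]_p ((heatk l p q)%:E * f p))%E.

Lemma heatk_ge0 l p q : 0 <= heatk l p q.
Proof. by rewrite /heatk; case: ifP => // _; rewrite mulr_ge0 ?expR_ge0 ?gauss_ge0. Qed.

Lemma heatk0_gt0 p q : p.1 < q.1 -> 0 < heatk 0 p q.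
Proof. by move=> pq; rewrite /heatk pq mulr_gt0 ?expR_gt0// gauss_gt0// subr_gt0. Qed.

Lemma heatk_eq0 l p q : q.1 <= p.1 -> heatk l p q = 0.
Proof. by move=> qp; rewrite /heatk ltNge qp. Qed.

Lemma heatkE l p q : heatk l p q = expR (- (l * (q.1 - p.1))) * heatk 0 p q.
Proof. by rewrite /heatk mul0r oppr0 expR0 mul1r; case: ifP; rewrite ?mulr0. Qed.

Lemma measurable_heatk d' (T : measurableType d') l (u v : T -> X) :
  measurable_fun setT u -> measurable_fun setT v ->
  measurable_fun setT (fun w => heatk l (u w) (v w)).
Proof.
move=> /measurable_fun_pairP[/= mu1 mu2] /measurable_fun_pairP[/= mv1 mv2].
have msub : measurable_fun setT (fun w => (v w).1 - (u w).1).
  exact: measurable_funB mv1 mu1.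
apply: measurable_fun_ifT => //; first exact: measurable_fun_ltr mu1 mv1.
apply: measurable_funM; last exact: measurable_gauss.
apply: (measurableT_comp (@measurable_expR R)).
exact: (measurableT_comp (@oppr_measurable R setT) (measurable_funM _ msub)).
Qed.

Lemma heatpot_ge0 l f q : (forall p, 0 <= f p)%E -> (0 <= heatpot l f q)%E.
Proof.
by move=> f0; apply: integral_ge0 => p _; rewrite mule_ge0// lee_fin heatk_ge0.
Qed.

Lemma measurable_heatk_mul l f q : measurable_fun setT f ->
  measurable_fun setT (fun p => (heatk l p q)%:E * f p)%E.
Proof.
move=> mf; apply: emeasurable_funM => //.
apply/measurable_EFinP; exact: measurable_heatk.
Qed.

Lemma measurable_heatpot l f : measurable_fun setT f -> (forall p, 0 <= f p)%E ->
  measurable_fun setT (heatpot l f).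
Proof.
move=> mf f0.
pose F (w : X * X) := ((heatk l w.2 w.1)%:E * f w.2)%E.
have mF : measurable_fun setT F.
  apply: emeasurable_funM; last exact: (measurableT_comp mf).
  apply/measurable_EFinP; exact: measurable_heatk.
have F0 w : (0 <= F w)%E by rewrite mule_ge0// lee_fin heatk_ge0.
have H := @measurable_fun_fubini_tonelli_F _ _ _ _ R mu F mF F0.
exact H.
Qed.

Lemma le_heatpot l f g q : measurable_fun setT f -> measurable_fun setT g ->
  (forall p, 0 <= f p)%E -> (forall p, p.1 < q.1 -> (f p <= g p)%E) ->
  (heatpot l f q <= heatpot l g q)%E.
Proof.
move=> mf mg f0 fg; apply: ge0_le_integral => //=.
- by move=> p _; rewrite mule_ge0// lee_fin heatk_ge0.
- exact: measurable_heatk_mul.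
- exact: measurable_heatk_mul.
- move=> p _; have [pq|qp] := ltP p.1 q.1; last by rewrite heatk_eq0// !mul0e.
  by rewrite lee_wpmul2l ?lee_fin ?heatk_ge0// fg.
Qed.

Lemma heatpotD l f g q : measurable_fun setT f -> measurable_fun setT g ->
  (forall p, 0 <= f p)%E -> (forall p, 0 <= g p)%E ->
  (heatpot l (f \+ g) q = heatpot l f q + heatpot l g q)%E.
Proof.
move=> mf mg f0 g0; rewrite /heatpot.
under eq_integral do rewrite ge0_muleDr//.
by rewrite ge0_integralD//=; do ?[exact: measurable_heatk_mul];
  move=> p _; rewrite mule_ge0// lee_fin heatk_ge0.
Qed.

Lemma heatpotZ l (c : R) f q : 0 <= c -> measurable_fun setT f ->
  (forall p, 0 <= f p)%E ->
  (heatpot l (fun p => c%:E * f p) q = c%:E * heatpot l f q)%E.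
Proof.
move=> c0 mf f0; rewrite /heatpot.
under eq_integral do rewrite muleCA.
rewrite ge0_integralZl_EFin//=; last exact: measurable_heatk_mul.
by move=> p _; rewrite mule_ge0// lee_fin heatk_ge0.
Qed.

Lemma integral_expR_interval l (a b : R) : 0 < l -> a < b ->
  (\int[lebesgue_measure]_(r in `]a, b[) (expR (- (l * (b - r))))%:E =
   (l^-1 * (1 - expR (- (l * (b - a)))))%:E)%E.
Proof.
move=> l0 ab.
pose F : R -> R := l^-1 \*: (expR \o (l \*: (id - cst b))).
pose f (r : R) := expR (- (l * (b - r))).
have FE r : F r = l^-1 * f r.
  by rewrite /F /f /= -mulrN opprB.
have dF (r : R) : is_derive r 1 F (f r).
  apply: is_derive_eq; rewrite /f /= subr0 /GRing.scale /= mulr1 mulrCA mulVf ?gt_eqF//.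
  by rewrite mulr1 -mulrN opprB.
have fE : f = l \*: F.
  by apply/funext => r /=; rewrite FE /GRing.scale /= mulrA mulfV ?mul1r// gt_eqF.
have cf : {within `[a, b], continuous f}.
  by apply: derivable_within_continuous => r _; rewrite fE; exact: derivableZ.
have mf : measurable_fun setT (EFin \o f).
  apply/measurable_EFinP; apply: (measurableT_comp (@measurable_expR R)).
  apply: (measurableT_comp (@oppr_measurable R setT)).
  by apply: measurable_funM => //; exact: measurable_funB.
rewrite integral_itv_bndo_bndc; last exact: (measurable_funTS mf).
rewrite integral_itv_obnd_cbnd; last exact: (measurable_funTS mf).
rewrite (integral_is_derive F f a b ab (fun r _ => dF r) cf) !FE /f.
by rewrite subrr mulr0 oppr0 expR0 -EFinB -mulrBr.
Qed.

(* The resolvent equation of the heat flow killed at rate [l], in kernel form. *)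
Lemma heatk_resolvent l p q : 0 < l ->
  (l%:E * (\int[mu]_r (heatk l r q * heatk 0 p r)%:E) + (heatk l p q)%:E =
   (heatk 0 p q)%:E)%E.
Proof.
move=> l0.
have mk : measurable_fun setT (fun r : X => (heatk l r q * heatk 0 p r)%:E).
  by apply/measurable_EFinP; apply: measurable_funM; exact: measurable_heatk.
have k0 (r : X) : (0 <= (heatk l r q * heatk 0 p r)%:E)%E.
  by rewrite lee_fin mulr_ge0 ?heatk_ge0.
have -> : (\int[mu]_r (heatk l r q * heatk 0 p r)%:E =
    (\int[lebesgue_measure]_r \int[lebesgue_tuple d]_z
      (heatk l (r, z) q * heatk 0 p (r, z))%:E))%E.
  exact: fubini_tonelli1.
case: p mk k0 => s x mk k0; case: q mk k0 => t y mk k0 /=.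
(* Chapman-Kolmogorov removes the spatial integral, so that only the killing factor is left to
   integrate over time. *)
have -> : (\int[lebesgue_measure]_r \int[lebesgue_tuple d]_z
      (heatk l (r, z) (t, y) * heatk 0 (s, x) (r, z))%:E =
    \int[lebesgue_measure]_(r in `]s, t[)
      ((gauss (t - s) x y)%:E * (expR (- (l * (t - r))))%:E))%E.
  rewrite [RHS]integral_mkcond; apply: eq_integral => r _; rewrite patchE.
  have [|] := boolP (r \in _).
    rewrite inE /= in_itv/= => /andP[sr rt].
    transitivity (\int[lebesgue_tuple d]_z ((expR (- (l * (t - r))))%:E *
        (gauss (r - s) x z * gauss (t - r) z y)%:E))%E.
      apply: eq_integral => z _; rewrite -EFinM /heatk /= sr rt mul0r oppr0 expR0.
      by rewrite mul1r -mulrA [X in _ * X]mulrC.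
    rewrite ge0_integralZl_EFin ?expR_ge0//=; last 2 first.
    - by move=> z _; rewrite lee_fin mulr_ge0 ?gauss_ge0.
    - apply/measurable_EFinP; apply: measurable_funM; exact: measurable_gauss.
    by rewrite gauss_chapman_kolmogorov ?subr_gt0// muleC [X in gauss X]addrC subrKA.
  move/negP; rewrite inE /= in_itv/= => /negP; rewrite negb_and -!leNgt => st.
  rewrite integral0_eq// => z _.
  case/orP : st => st; first by rewrite (heatk_eq0 0 (s, x) (r, z) st) mulr0.
  by rewrite (heatk_eq0 l (r, z) (t, y) st) mul0r.
have [st|ts] := ltP s t; last first.
  rewrite !heatk_eq0// adde0 set_itv_ge -?leNgt ?bnd_simp//.
  by rewrite integral_set0 mule0.
rewrite ge0_integralZl_EFin ?gauss_ge0//=; last first.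
  apply/measurable_funTS/measurable_EFinP.
  apply: (measurableT_comp (@measurable_expR R)).
  apply: (measurableT_comp (@oppr_measurable R setT)).
  by apply: measurable_funM => //; exact: measurable_funB.
rewrite integral_expR_interval// -!EFinM -EFinD /heatk/= st; congr (_%:E).
rewrite mul0r oppr0 expR0 mul1r; field.
by rewrite gt_eqF.
Qed.

(** The kernel identity integrated against [f], by Tonelli. Written with sums only, it holds also
    where the potentials are infinite. *)
Lemma heatpot_resolvent l f q : 0 < l -> measurable_fun setT f ->
  (forall p, 0 <= f p)%E ->
  (l%:E * heatpot l (heatpot 0 f) q + heatpot l f q = heatpot 0 f q)%E.
Proof.
move=> l0 mf f0.
have k0 l' p r : (0 <= (heatk l' p r)%:E)%E by rewrite lee_fin heatk_ge0.
have mk : measurable_fun setT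
    (fun w : X * X => (heatk l w.1 q * heatk 0 w.2 w.1)%:E * f w.2)%E.
  apply: emeasurable_funM; last exact: (measurableT_comp mf).
  by apply/measurable_EFinP; apply: measurable_funM; exact: measurable_heatk.
have -> : (heatpot l (heatpot 0 f) q =
    \int[mu]_r \int[mu]_p ((heatk l r q * heatk 0 p r)%:E * f p))%E.
  apply: eq_integral => r _.
  rewrite -ge0_integralZl_EFin ?heatk_ge0//=.
  - by apply: eq_integral => p _; rewrite muleA -EFinM.
  - by move=> p _; rewrite mule_ge0.
  - exact: measurable_heatk_mul.
have k20 p r : (0 <= (heatk l r q * heatk 0 p r)%:E)%E.
  by rewrite lee_fin mulr_ge0 ?heatk_ge0.
rewrite (fubini_tonelli (m1 := mu) (m2 := mu)
  (fun w : X * X => (heatk l w.1 q * heatk 0 w.2 w.1)%:E * f w.2)%E)//=; last first.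
  by move=> w; rewrite mule_ge0.
have mI : measurable_fun setT (fun p => \int[mu]_r (heatk l r q * heatk 0 p r)%:E)%E.
  apply: (@measurable_fun_fubini_tonelli_G _ _ X X R mu
    (fun w : X * X => (heatk l w.1 q * heatk 0 w.2 w.1)%:E)) => [|w]; last exact: k20.
  by apply/measurable_EFinP; apply: measurable_funM; exact: measurable_heatk.
have I0 p : (0 <= \int[mu]_r (heatk l r q * heatk 0 p r)%:E)%E by exact: integral_ge0.
under eq_integral => p _.
  rewrite ge0_integralZr//=; last first.
    by apply/measurable_EFinP; apply: measurable_funM; exact: measurable_heatk.
  over.
rewrite -ge0_integralZl_EFin ?(ltW l0)//=; last 2 first.
- by move=> p _; rewrite mule_ge0.
- exact: emeasurable_funM.
rewrite -ge0_integralD//=; last 4 first.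
- by move=> p _; rewrite mule_ge0 ?lee_fin ?(ltW l0)// mule_ge0.
- by apply: emeasurable_funM => //; exact: emeasurable_funM.
- by move=> p _; rewrite mule_ge0.
- exact: measurable_heatk_mul.
apply: eq_integral => p _; rewrite muleA -ge0_muleDl//; last first.
  by rewrite mule_ge0 ?lee_fin ?(ltW l0).
by rewrite heatk_resolvent.
Qed.

End heat_potential.

(** * Solutions of the Duhamel equation *)

Section duhamel.
Context {R : realType} {d : nat}.
Local Notation X := (measurableTypeR R * d.-tuple R)%type.
Local Notation mu := (@spacetime R d).
Implicit Types (l : R) (p q : X) (u v w f g h : X -> R).

(** The density is real valued, so that it can be truncated and split by sign, while the potential
    may be infinite. *)
Definition rpot l h q : \bar R := heatpot l (fun p => (h p)%:E) q.

Lemma rpot_ge0 l h q : (forall p, 0 <= h p) -> (0 <= rpot l h q)%E.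
Proof. by move=> h0; apply: heatpot_ge0 => p; rewrite lee_fin. Qed.

Lemma le_rpot l g h q : measurable_fun setT g -> measurable_fun setT h ->
  (forall p, 0 <= g p) -> (forall p, p.1 < q.1 -> g p <= h p) ->
  (rpot l g q <= rpot l h q)%E.
Proof.
move=> mg mh g0 gh; apply: le_heatpot => [| | p | p pq].
- exact/measurable_EFinP.
- exact/measurable_EFinP.
- by rewrite lee_fin.
- by rewrite lee_fin gh.
Qed.

Lemma rpotD l g h q : measurable_fun setT g -> measurable_fun setT h ->
  (forall p, 0 <= g p) -> (forall p, 0 <= h p) ->
  (rpot l (fun p => (g p + h p)%R) q = rpot l g q + rpot l h q)%E.
Proof.
move=> mg mh g0 h0; rewrite /rpot -heatpotD//; exact/measurable_EFinP.
Qed.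

Lemma rpotZ l (c : R) h q : 0 <= c -> measurable_fun setT h ->
  (forall p, 0 <= h p) -> (rpot l (fun p => (c * h p)%R) q = c%:E * rpot l h q)%E.
Proof.
move=> c0 mh h0; rewrite /rpot -heatpotZ//; exact/measurable_EFinP.
Qed.

Lemma measurable_rpot l h : measurable_fun setT h -> (forall p, 0 <= h p) ->
  measurable_fun setT (fun q => fine (rpot l h q)).
Proof.
move=> mh h0; apply: (measurableT_comp (@fine_measurable R setT measurableT)).
apply: measurable_heatpot; first exact/measurable_EFinP.
by move=> p; rewrite lee_fin.
Qed.

(** Presents a potential as an [l]-resolvent of a density that involves the potential itself, which
    is the form that [comparison] takes. *)
Lemma rpot_resolvent l h q : 0 < l -> measurable_fun setT h -> (forall p, 0 <= h p) ->
  (forall p, rpot 0 h p \is a fin_num) ->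
  (rpot l (fun p => (h p + l * fine (rpot 0%R h p))%R) q = rpot 0%R h q)%E.
Proof.
move=> l0 mh h0 fh; have U0 p : 0 <= fine (rpot 0%R h p) by rewrite fine_ge0// rpot_ge0.
have mU := measurable_rpot 0 h mh h0.
rewrite rpotD//; last 2 first.
- exact: measurable_funM.
- by move=> p; rewrite mulr_ge0// ltW.
rewrite rpotZ ?(ltW l0)// [RHS]/rpot -(@heatpot_resolvent _ _ l)//; last first.
  exact/measurable_EFinP.
rewrite addeC; congr (_ * _ + _)%E.
by congr (heatpot l _ q); apply/funext => p; rewrite fineK.
Qed.

(* If [u] exceeds [A] then so does its mean over an exponential time, up to the
   geometrically decaying [B]; iterating kills the excess. *)
Lemma comparison l u (A k B zeta eta : X -> R) : 0 < l ->
  measurable_fun setT u -> measurable_fun setT A -> measurable_fun setT B ->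
  measurable_fun setT zeta -> measurable_fun setT eta ->
  (forall q, 0 <= B q) -> (forall q, 0 <= zeta q) -> (forall q, 0 <= eta q) ->
  (forall T, exists2 c : R, 0 <= c < 1 &
    forall q, q.1 <= T -> (l%:E * rpot l B q <= (c * B q)%:E)%E) ->
  (forall q, u q <= A q + B q) ->
  (forall q, (u q)%:E <= (k q)%:E + rpot l zeta q)%E ->
  (forall q, (k q)%:E + rpot l eta q <= (A q)%:E)%E ->
  (forall q, zeta q <= eta q + l * Num.max 0 (u q - A q)) ->
  forall q, u q <= A q.
Proof.
move=> l0 mu_ mA mB mz me B0 z0 e0 decay uAB uk kA zeta_le q.
pose w p := Num.max 0 (u p - A p).
have w0 p : 0 <= w p by rewrite le_max lexx.
have mw : measurable_fun setT w by apply: measurable_maxr => //; exact: measurable_funB.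
have wB p : w p <= B p by rewrite ge_max B0 lerBlDl uAB.
(* Where [u > A], the bounds on [u], [zeta] and [k] chain to [u <= A + l * rpot l w]. *)
have wT p : ((w p)%:E <= l%:E * rpot l w p)%E.
  rewrite /w; have [uA|uA] := leP (u p - A p) 0.
    by rewrite mule_ge0 ?rpot_ge0 ?lee_fin ?(ltW l0).
  rewrite EFinB leeBlDl//.
  apply: (le_trans (uk p)).
  apply: (@le_trans _ _ ((k p)%:E + (rpot l eta p + l%:E * rpot l w p))%E).
    rewrite leeD2l// -rpotZ ?(ltW l0)// -rpotD//; last 2 first.
    - exact: measurable_funM.
    - by move=> r; rewrite mulr_ge0// ltW.
    apply: le_rpot => //.
    by apply: measurable_funD => //; exact: measurable_funM.
  by rewrite addeA leeD2r.
have [c /andP[c0 c1] cB] := decay q.1.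
(* A potential at [p] sees only times before [p.1], so the contraction constant for times up to
   [q.1] serves at every iteration. *)
have wcn n p : p.1 <= q.1 -> w p <= c ^+ n * B p.
  elim: n p => [|n IH] p pq; first by rewrite expr0 mul1r.
  rewrite -lee_fin; apply: (le_trans (wT p)).
  apply: (@le_trans _ _ (l%:E * rpot l (fun r => (c ^+ n * B r)%R) p)%E).
    rewrite lee_wpmul2l ?lee_fin ?(ltW l0)//; apply: le_rpot => //.
      exact: measurable_funM.
    by move=> r rp; apply: IH; rewrite (le_trans _ pq)// ltW.
  rewrite rpotZ ?exprn_ge0// muleCA.
  rewrite (le_trans (lee_wpmul2l _ (cB p pq))) ?lee_fin ?exprn_ge0//.
  by rewrite exprSr mulrA.
have : w q <= 0.
  apply: (cvgr_to_ge (@cvg_geometric _ (B q) c _)); first by rewrite ger0_norm.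
  by apply: nearW => n; rewrite /= mulrC wcn.
by rewrite ge_max lexx /= subr_le0.
Qed.

(** This is [rpot_resolvent] with the nonnegative term [rpot l h] dropped. *)
Lemma rpot_supermedian l h q : 0 < l -> measurable_fun setT h -> (forall p, 0 <= h p) ->
  (forall p, rpot 0 h p \is a fin_num) ->
  (l%:E * rpot l (fun p => fine (rpot 0%R h p)) q <= (fine (rpot 0%R h q))%:E)%E.
Proof.
move=> l0 mh h0 fh.
have U0 p : 0 <= fine (rpot 0 h p) by rewrite fine_ge0// rpot_ge0.
have mU := measurable_rpot 0 h mh h0.
rewrite fineK// -(rpot_resolvent l)// rpotD//; last 2 first.
- exact: measurable_funM.
- by move=> p; rewrite mulr_ge0// ltW.
by rewrite -rpotZ ?(ltW l0)// leeDr// rpot_ge0.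
Qed.

(** Since [h] lives on positive times, a particle that reaches a time at most [T] has aged by at
    most [T], so killing keeps a fraction [e] of the potential: [rpot l h >= e * rpot 0 h]. The
    resolvent identity leaves at most [1 - e] for the other term. *)
Lemma rpot_decay l h T : 0 < l -> measurable_fun setT h -> (forall p, 0 <= h p) ->
  (forall p, p.1 <= 0 -> h p = 0) -> (forall p, rpot 0 h p \is a fin_num) ->
  exists2 c : R, 0 <= c < 1 & forall q, q.1 <= T ->
    (l%:E * rpot l (fun p => fine (rpot 0%R h p)) q <= (c * fine (rpot 0%R h q))%:E)%E.
Proof.
move=> l0 mh h0 hneg fh.
have U0 p : 0 <= fine (rpot 0 h p) by rewrite fine_ge0// rpot_ge0.
have mU := measurable_rpot 0 h mh h0.
pose e := expR (- (l * Num.max 0 T)).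
exists (1 - e) => [|q qT].
  rewrite subr_ge0 ltrBlDl ltrDr expR_gt0 andbT -[leRHS]expR0 ler_expR oppr_le0.
  by rewrite mulr_ge0 ?(ltW l0)// le_max lexx.
have := rpot_resolvent l h q l0 mh h0 fh; rewrite rpotD//; last 2 first.
- exact: measurable_funM.
- by move=> p; rewrite mulr_ge0// ltW.
rewrite rpotZ ?(ltW l0)// addeC => E.
have H : (e%:E * rpot 0%R h q <= rpot l h q)%E.
  rewrite -rpotZ ?expR_ge0//; apply: ge0_le_integral => //=.
  - by move=> p _; rewrite mule_ge0 ?lee_fin ?heatk_ge0 ?mulr_ge0 ?expR_ge0.
  - by apply: measurable_heatk_mul; apply/measurable_EFinP; exact: measurable_funM.
  - by apply: measurable_heatk_mul; exact/measurable_EFinP.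
  move=> p _; have [p0|p0] := ltP 0 p.1; last by rewrite hneg// mulr0 !mule0.
  have [pq|qp] := ltP p.1 q.1; last by rewrite !heatk_eq0// !mul0e.
  rewrite -!EFinM lee_fin mulrCA mulrA ler_wpM2r// (heatkE l) ler_wpM2r ?heatk_ge0//.
  rewrite ler_expR lerN2 ler_wpM2l ?(ltW l0)// le_max; apply/orP; right.
  by rewrite lerBlDr (le_trans qT)// lerDl ltW.
have F : rpot l h q \is a fin_num.
  rewrite ge0_fin_numE ?rpot_ge0//; apply: (@le_lt_trans _ _ (rpot 0%R h q)).
    by rewrite -E leeDr// mule_ge0 ?rpot_ge0 ?lee_fin ?(ltW l0).
  by rewrite -ge0_fin_numE ?rpot_ge0.
rewrite -[X in (X <= _)%E](addeK _ F) E leeBlDr//.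
move: H F (fh q); case: (rpot 0 h q) => [a| |] //; case: (rpot l h q) => [b| |] //.
by rewrite -EFinM -EFinD !lee_fin /= => *; lra.
Qed.

(** Monotone convergence. It reduces an unbounded [v] to bounded truncations, for which some rate
    [l] dominates. *)
Lemma rpot_truncate v h q (c : \bar R) :
  measurable_fun setT v -> measurable_fun setT h ->
  (forall p, 0 <= v p) -> (forall p, 0 <= h p) ->
  (forall n, (rpot 0%R (fun p => (Num.min (v p) n.+1%:R * h p)%R) q <= c)%E) ->
  (rpot 0%R (fun p => (v p * h p)%R) q <= c)%E.
Proof.
move=> mv mh v0 h0 le_c.
pose g n p : \bar R := ((heatk 0 p q)%:E * (Num.min (v p) n.+1%:R * h p)%:E)%E.
have mg n : measurable_fun setT (g n).
  apply: measurable_heatk_mul; apply/measurable_EFinP; apply: measurable_funM => //.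
  exact: measurable_minr.
have g0 n p : setT p -> (0 <= g n p)%E.
  by rewrite mule_ge0 ?lee_fin ?heatk_ge0// mulr_ge0// le_min v0/=.
have ndg p : setT p -> {homo g^~ p : n m / (n <= m)%N >-> (n <= m)%E}.
  move=> _ n m nm; rewrite /g -!EFinM lee_fin ler_wpM2l ?heatk_ge0// ler_wpM2r//.
  by rewrite le_min ge_min lexx /= ge_min ler_nat ltnS nm orbT.
have /cvge_to_le : _ := cvg_monotone_convergence (mu := mu) measurableT mg g0 ndg.
move=> /(_ c); rewrite (_ : (\int[mu]_p _)%E = rpot 0 (fun p => v p * h p) q).
  by apply; exact: nearW.
apply: eq_integral => p _; apply: cvg_lim => //.
apply: cvg_near_cst; exists (Num.truncn (v p)) => // n /= vn.
rewrite /g min_l// ltW// (lt_le_trans (truncnS_gt _)) ?ler_nat ?ltnS//.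
Qed.

(* Domination principle: where [f > 0], the potential of [min v l * f^+] is below the
   supermedian [A = g + rpot 0 (v * f^-)] with room [f >= l^-1 * (min v l * f^+)] to
   spare, hence it is below [A] everywhere; then let [l] go to infinity. *)
Lemma duhamel_ge0 v f g :
  measurable_fun setT v -> measurable_fun setT f -> measurable_fun setT g ->
  (forall p, 0 <= v p) -> (forall p, 0 <= g p) ->
  (forall p, p.1 <= 0 -> f p = 0) ->
  (forall l q, 0 < l -> (l%:E * rpot l g q <= (g q)%:E)%E) ->
  let P := rpot 0%R (fun p => v p * Num.max 0 (f p)) in
  let N := rpot 0%R (fun p => v p * Num.max 0 (- f p)) in
  (forall q, P q \is a fin_num) -> (forall q, N q \is a fin_num) ->
  (forall q, f q = g q + fine (N q) - fine (P q)) ->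
  forall q, 0 <= f q.
Proof.
move=> mv mf mg v0 g0 fneg gsup P N finP finN fE q.
pose fp p := Num.max 0 (f p); pose fn p := Num.max 0 (- f p).
have fp0 p : 0 <= fp p by rewrite le_max lexx.
have fn0 p : 0 <= fn p by rewrite le_max lexx.
have mfp : measurable_fun setT fp by apply: measurable_maxr.
have mfn : measurable_fun setT fn.
  by apply: measurable_maxr => //; exact: (measurableT_comp (@oppr_measurable R setT)).
have mvp : measurable_fun setT (fun p => v p * fp p) by exact: measurable_funM.
have mvn : measurable_fun setT (fun p => v p * fn p) by exact: measurable_funM.
have vp0 p : 0 <= v p * fp p by rewrite mulr_ge0.
have vn0 p : 0 <= v p * fn p by rewrite mulr_ge0.
have P0 p : 0 <= fine (P p) by rewrite fine_ge0// rpot_ge0.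
have N0 p : 0 <= fine (N p) by rewrite fine_ge0// rpot_ge0.
have mP := measurable_rpot 0 _ mvp vp0.
have mN := measurable_rpot 0 _ mvn vn0.
pose A p := g p + fine (N p).
have mA : measurable_fun setT A by exact: measurable_funD.
have A0 p : 0 <= A p by rewrite addr_ge0.
suff : (P q <= (A q)%:E)%E.
  by rewrite -(fineK (finP q)) lee_fin fE subr_ge0.
apply: rpot_truncate => // n.
pose l : R := n.+1%:R; have l0 : 0 < l by rewrite ltr0n.
pose phi p := Num.min (v p) l * fp p.
have mphi : measurable_fun setT phi.
  by apply: measurable_funM => //; exact: measurable_minr.
have phi0 p : 0 <= phi p by rewrite mulr_ge0// le_min v0 ltW.
have phiP p : (rpot 0 phi p <= P p)%E.
  by apply: le_rpot => // r _; rewrite ler_wpM2r// ge_min lexx.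
have finU p : rpot 0 phi p \is a fin_num.
  by rewrite ge0_fin_numE ?rpot_ge0// (le_lt_trans (phiP p))// -ge0_fin_numE ?rpot_ge0.
have U0 p : 0 <= fine (rpot 0 phi p) by rewrite fine_ge0// rpot_ge0.
have mU := measurable_rpot 0 _ mphi phi0.
have UP p : fine (rpot 0 phi p) <= fine (P p) by rewrite fine_le.
rewrite -(fineK (finU q)) lee_fin.
(* Here [k = 0]: the potential of [phi] is exactly a resolvent, and the resolvent of [l * A] is at
   most [A] because both summands of [A] are supermedian. The a priori excess is the full potential
   of [v * f^+]. *)
apply: (comparison l (fun p => fine (rpot 0 phi p)) A (fun=> 0)
  (fun p => fine (P p)) (fun p => phi p + l * fine (rpot 0 phi p))
  (fun p => l * A p)) => //.
- by apply: measurable_funD => //; exact: measurable_funM.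
- exact: measurable_funM.
- by move=> p; rewrite addr_ge0// mulr_ge0// ltW.
- by move=> p; rewrite mulr_ge0// ltW.
- move=> T; apply: rpot_decay => // p p0.
  by rewrite /fp fneg// maxxx mulr0.
- by move=> p; rewrite (le_trans (UP p))// lerDr.
- by move=> p; rewrite add0e rpot_resolvent// fineK.
- move=> p; rewrite add0e rpotZ ?(ltW l0)// rpotD// ge0_muleDr ?rpot_ge0// EFinD.
  apply: leeD; first exact: gsup.
  exact: rpot_supermedian.
- move=> p; have UA : fine (rpot 0 phi p) <= A p + Num.max 0 (fine (rpot 0 phi p) - A p).
    by rewrite -lerBlDl le_max lexx orbT.
  have := ler_wpM2l (ltW l0) UA; rewrite mulrDr.
  (* Where [f <= 0] the density [phi] vanishes. Elsewhere [phi <= l * f = l * (A - P)], and the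
     potential of [phi] is at most [P], so [phi] plus [l] times that potential is at most
     [l * A]. *)
  have [fp_le|fp_gt] := leP (f p) 0.
    by have -> : phi p = 0 by [rewrite /phi /fp max_l ?mulr0]; rewrite add0r.
  move=> _; apply: (@le_trans _ _ (l * A p)); last first.
    by rewrite lerDl mulr_ge0 ?(ltW l0)// le_max lexx.
  have phil : phi p <= l * f p.
    by rewrite /phi /fp max_r ?(ltW fp_gt)// ler_wpM2r ?(ltW fp_gt)// ge_min lexx orbT.
  rewrite (le_trans (lerD phil (lexx _)))// -mulrDr ler_wpM2l ?(ltW l0)//.
  by rewrite fE -/(A p) addrAC -lerBrDr opprK lerD2l UP.
Qed.

End duhamel.

(** Applied with [r = v / l], it bounds the survival probability at a ring of the clock by an
    exponential, and is the origin of the factor 2 in [duhamel_lower]. As [exp (2 r) >= 1 + 2 r], it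
    reduces to [(1 - r) (1 + 2 r) >= 1]. *)
Lemma expRN2_le {R : realType} (r : R) : 0 <= r <= 2^-1 -> expR (- (2 * r)) <= 1 - r.
Proof.
move=> /andP[r0 r1]; rewrite -(ler_pM2r (expR_gt0 (2 * r))) -expRD addNr expR0.
have e := expR_ge1Dx (2 * r); apply: (@le_trans _ _ ((1 - r) * (1 + 2 * r))).
  by nra.
by rewrite ler_wpM2l// subr_ge0; lra.
Qed.

(** * The lower bound for [f] by Jensen's inequality *)

Section duhamel_lower.
Context {R : realType} {d : nat}.
Local Notation X := (measurableTypeR R * d.-tuple R)%type.
Implicit Types (l : R) (p q : X) (x : d.-tuple R) (v f : X -> R).

(** The function [g] on spacetime: the Gaussian started from [x] at time 0, continued by 0 to
    nonpositive times. *)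
Definition heat_source x q : R := heatk 0 ((0 : R), x) q.

Lemma heat_source_ge0 x q : 0 <= heat_source x q.
Proof. exact: heatk_ge0. Qed.

Lemma heat_source_gauss x (t : R) y : 0 < t -> heat_source x (t, y) = gauss t x y.
Proof. by move=> t0; rewrite /heat_source /heatk /= t0 subr0 mul0r oppr0 expR0 mul1r. Qed.

Lemma measurable_heat_source x : measurable_fun setT (heat_source x).
Proof. exact: measurable_heatk. Qed.

(** The source is the potential of a point mass, which has no density, so its resolvent identity
    comes from the kernel form and not from [rpot_resolvent]. *)
Lemma heat_source_resolvent l x q : 0 < l ->
  (l%:E * rpot l (heat_source x) q + (heatk l ((0%R : R), x) q)%:E = (heat_source x q)%:E)%E.
Proof.
move=> l0; rewrite -(heatk_resolvent l ((0 : R), x) q)//; congr (_ * _ + _)%E.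
Qed.

Lemma heat_source_supermedian l x q : 0 < l ->
  (l%:E * rpot l (heat_source x) q <= (heat_source x q)%:E)%E.
Proof.
by move=> l0; rewrite -(heat_source_resolvent l)// leeDl// lee_fin heatk_ge0.
Qed.

Lemma heat_source_decay l x T : 0 < l -> exists2 c : R, 0 <= c < 1 &
  forall q, q.1 <= T -> (l%:E * rpot l (heat_source x) q <= (c * heat_source x q)%:E)%E.
Proof.
move=> l0; pose e := expR (- (l * Num.max 0 T)).
exists (1 - e) => [|q qT].
  rewrite subr_ge0 ltrBlDl ltrDr expR_gt0 andbT -[leRHS]expR0 ler_expR oppr_le0.
  by rewrite mulr_ge0 ?(ltW l0)// le_max lexx.
have := heat_source_resolvent l x q l0.
have : e * heat_source x q <= heatk l ((0 : R), x) q.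
  have [q0|q0] := ltP 0 q.1; last by rewrite /heat_source !heatk_eq0// mulr0.
  rewrite (heatkE l) ler_wpM2r ?heatk_ge0// ler_expR lerN2 ler_wpM2l ?(ltW l0)//.
  by rewrite /= subr0 le_max qT orbT.
case: (rpot l _ q) => [b| |] //=.
- by rewrite -EFinM -EFinD => H [] E; rewrite lee_fin; lra.
- by rewrite gt0_muley.
- by rewrite gt0_muleNy.
Qed.

(** With [W] the potential of [v * g] and [S = W / g <= M], it suffices that
    [psi = g * exp (- 2 S) <= f]. Jensen makes [psi] a subsolution for the clock of rate [l] with
    survival probability [1 - vn / l]. Then [comparison] gives [psi + U <= g] for the potential [U]
    of the truncated density, and the truncation is removed at the end. *)
Lemma duhamel_lower v f x (M : R) :
  measurable_fun setT v -> measurable_fun setT f ->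
  (forall p, 0 <= v p) -> (forall p, 0 <= f p) ->
  (forall q, rpot 0%R (fun p => v p * f p) q \is a fin_num) ->
  (forall q, f q = heat_source x q - fine (rpot 0 (fun p => v p * f p) q)) ->
  (forall q, (rpot 0%R (fun p => (v p * heat_source x p)%R) q
    <= (M * heat_source x q)%:E)%E) ->
  forall q, expR (- (2 * M)) * heat_source x q <= f q.
Proof.
move=> mv mf v0 f0 finP fE leM q.
pose g := heat_source x; have g0 p : 0 <= g p by exact: heat_source_ge0.
have mg : measurable_fun setT g by exact: measurable_heat_source.
have mvg : measurable_fun setT (fun p => v p * g p) by exact: measurable_funM.
have vg0 p : 0 <= v p * g p by rewrite mulr_ge0.
have mvf : measurable_fun setT (fun p => v p * f p) by exact: measurable_funM.
have vf0 p : 0 <= v p * f p by rewrite mulr_ge0.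
have finW p : rpot 0 (fun p => v p * g p) p \is a fin_num.
  by rewrite ge0_fin_numE ?rpot_ge0// (le_lt_trans (leM p))// ltry.
pose W p := fine (rpot 0 (fun p => v p * g p) p).
have W0 p : 0 <= W p by rewrite fine_ge0// rpot_ge0.
have mW : measurable_fun setT W by exact: measurable_rpot.
have WM p : W p <= M * g p by rewrite -lee_fin fineK.
pose S p := W p / g p; have S0 p : 0 <= S p by rewrite divr_ge0.
(* Where [g] vanishes so does [W], by [W <= M * g]; the value 0 of a division by 0 is therefore
   harmless. *)
have Sg p : S p * g p = W p.
  have [gp|gp] := eqVneq (g p) 0; last by rewrite divfK.
  by apply/eqP; rewrite gp mulr0 eq_le W0 /= (le_trans (WM p))// gp mulr0.
have mS : measurable_fun setT S.
  by apply: measurable_funM => //; exact: (measurableT_comp measurable_invr).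
pose psi p := g p * expR (- (2 * S p)).
have psi0 p : 0 <= psi p by rewrite mulr_ge0// expR_ge0.
have psig p : psi p <= g p.
  by rewrite ler_piMr// -[leRHS]expR0 ler_expR oppr_le0 mulr_ge0.
have mpsi : measurable_fun setT psi.
  apply: measurable_funM => //; apply: (measurableT_comp (@measurable_expR R)).
  by apply: (measurableT_comp (@oppr_measurable R setT)); exact: measurable_funM.
suff : psi q <= f q.
  have [gq|gq] := eqVneq (g q) 0; first by rewrite -/(g q) gq mulr0 f0.
  apply: le_trans; rewrite mulrC ler_wpM2l// ler_expR lerN2 ler_wpM2l//.
  by rewrite ler_pdivrMr// lt_neqAle eq_sym gq g0.
suff : (rpot 0%R (fun p => (v p * f p)%R) q <= (g q - psi q)%:E)%E.
  by rewrite fE -/(g q) -(fineK (finP q)) lee_fin lerBrDr addrC -lerBrDr.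
apply: rpot_truncate => // n.
(* Twice the truncation level, so that [vn / l <= 1 / 2] as [expRN2_le] requires. *)
pose l : R := 2 * n.+1%:R; have l0 : 0 < l by rewrite mulr_gt0.
pose vn p := Num.min (v p) n.+1%:R.
have vn0 p : 0 <= vn p by rewrite le_min v0/=.
have vnv p : vn p <= v p by rewrite ge_min lexx.
have vnl p : vn p <= l / 2 by rewrite /l mulrC mulKf// ge_min lexx orbT.
have mvn : measurable_fun setT vn by exact: measurable_minr.
have mphi : measurable_fun setT (fun p => vn p * f p) by exact: measurable_funM.
have phi0 p : 0 <= vn p * f p by rewrite mulr_ge0.
have UP p : (rpot 0%R (fun p => (vn p * f p)%R) p <= rpot 0%R (fun p => (v p * f p)%R) p)%E.
  by apply: le_rpot => // r _; rewrite ler_wpM2r.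
have finU p : rpot 0 (fun p => vn p * f p) p \is a fin_num.
  by rewrite ge0_fin_numE ?rpot_ge0// (le_lt_trans (UP p))// -ge0_fin_numE ?rpot_ge0.
pose U p := fine (rpot 0 (fun p => vn p * f p) p).
have U0 p : 0 <= U p by rewrite fine_ge0// rpot_ge0.
have mU : measurable_fun setT U by exact: measurable_rpot.
have fU p : f p <= g p - U p.
  by rewrite fE -/(g p) lerD2l lerN2 fine_le.
have Ug p : U p <= g p by rewrite -subr_ge0 (le_trans (f0 p)).
pose zeta1 p := (l - vn p) * psi p.
have lvn p : 0 <= l - vn p by have := vnl p; rewrite subr_ge0; lra.
have zeta10 p : 0 <= zeta1 p by rewrite mulr_ge0.
have mzeta1 : measurable_fun setT zeta1.
  by apply: measurable_funM => //; exact: measurable_funB.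
(* Jensen's inequality for [exp (- a)], through its tangent at [a = 2 * m]. *)
have jensen p : ((psi p)%:E <= (heatk l ((0%R : R), x) p)%:E + rpot l zeta1 p)%E.
  set m := S p; set c := expR (- (2 * m)).
  have c0 : 0 <= c by exact: expR_ge0.
  have m0 : 0 <= 2 * m by rewrite mulr_ge0 ?S0.
  (* The tangent inequality, multiplied by [g] and integrated against the resolvent kernel. The
     terms linear in [v] and [S] recombine into [W] by [rpot_resolvent]. *)
  have : ((c * (1 + 2 * m))%:E * (l%:E * rpot l g p) <=
      rpot l zeta1 p + (c * 2)%:E * (W p)%:E)%E.
    rewrite -rpotZ ?(ltW l0)// -rpotZ ?mulr_ge0 ?addr_ge0//; last 2 first.
    - exact: measurable_funM.
    - by move=> r; rewrite mulr_ge0// ltW.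
    rewrite /W fineK// -(rpot_resolvent l)// -rpotZ ?mulr_ge0//; last 2 first.
    - by apply: measurable_funD => //; exact: (measurable_funM _ mW).
    - by move=> r; rewrite addr_ge0// mulr_ge0 ?(ltW l0)//; exact: W0.
    rewrite -rpotD//; last 2 first.
    - by apply: measurable_funM => //; apply: measurable_funD => //; exact: (measurable_funM _ mW).
    - move=> r; rewrite mulr_ge0 ?mulr_ge0// addr_ge0// mulr_ge0 ?(ltW l0)//; exact: W0.
    apply: le_rpot.
    - by apply: measurable_funM => //; exact: measurable_funM.
    - apply: measurable_funD => //.
      by apply: measurable_funM => //; apply: measurable_funD => //; exact: (measurable_funM _ mW).
    - by move=> r; rewrite mulr_ge0 ?mulr_ge0 ?addr_ge0// ltW.
    move=> r _; rewrite -/(W r) -Sg /zeta1 /psi.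
    suff H : c * (1 + 2 * m) * l <= (l - vn r) * expR (- (2 * S r)) + c * 2 * (v r + l * S r).
      by have := ler_wpM2r (g0 r) H; lra.
    pose a := 2 * (v r / l) + 2 * S r.
    have H1 : expR (- (2 * (v r / l))) * l <= l - vn r.
      have ln0 : l != 0 by rewrite gt_eqF.
      rewrite [leRHS](_ : _ = (1 - vn r / l) * l); last by field.
      rewrite ler_pM2r//; apply: (@le_trans _ _ (expR (- (2 * (vn r / l))))).
        by rewrite ler_expR lerN2 ler_wpM2l// ler_wpM2r// invr_ge0 ltW.
      apply: expRN2_le; rewrite divr_ge0 ?(ltW l0)//= ler_pdivrMr// mulrC.
      exact: vnl.
    have H2 : l * expR (- a) <= (l - vn r) * expR (- (2 * S r)).
      rewrite /a opprD expRD mulrA [l * _]mulrC ler_wpM2r ?expR_ge0//.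
    have H3 : c * (1 + (2 * m - a)) <= expR (- a).
      have -> : expR (- a) = c * expR (2 * m - a) by rewrite /c -expRD addKr.
      by rewrite ler_wpM2l// expR_ge1Dx.
    have H4 : l * a = 2 * (v r + l * S r) by rewrite /a; field; rewrite gt_eqF.
    have := ler_wpM2l (ltW l0) H3; nra.
  (* After [l * rpot l g] is replaced by [g - heatk l], the kernel carries this factor, which may
     thus be dropped. *)
  have c1 : c * (1 + 2 * m) <= 1.
    have := ler_wpM2l c0 (expR_ge1Dx (2 * m)).
    by rewrite /c -expRD addNr expR0.
  have k0 : 0 <= heatk l ((0 : R), x) p by exact: heatk_ge0.
  have psiE : psi p = c * g p by rewrite /psi mulrC.
  have WE : W p = m * g p by rewrite Sg.
  move: (heat_source_resolvent l x p l0) (rpot_ge0 l zeta1 p zeta10).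
  rewrite -/g.
  case: (rpot l g p) => [b| |] //=.
  - rewrite -EFinM -EFinD => -[] E.
    case: (rpot l zeta1 p) => [z| |] // _; rewrite ?leey//.
    rewrite -!EFinM -!EFinD !lee_fin psiE WE.
    have -> : l * b = g p - heatk l ((0 : R), x) p by rewrite -E addrK.
    have := mulr_ge0 k0 (_ : 0 <= 1 - c * (1 + 2 * m)); rewrite subr_ge0 => /(_ c1).
    lra.
  - by rewrite gt0_muley.
  - by rewrite gt0_muleNy.
rewrite -(fineK (finU q)) lee_fin -/(U q) lerBrDr addrC.
(* Both [psi] and [U] are at most [g], so the a priori excess over [g] is [g] itself, which decays
   by [heat_source_decay]. *)
apply: (comparison l (fun p => psi p + U p) g (heatk l ((0 : R), x)) g
  (fun p => zeta1 p + (vn p * f p + l * U p)) (fun p => l * g p)) => //.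
- exact: measurable_funD.
- apply: measurable_funD => //; apply: measurable_funD => //; exact: measurable_funM.
- exact: measurable_funM.
- by move=> p; rewrite addr_ge0// addr_ge0// mulr_ge0// ltW.
- by move=> p; rewrite mulr_ge0// ltW.
- move=> T; exact: heat_source_decay.
- by move=> p; rewrite lerD.
- move=> p; rewrite rpotD//; last 2 first.
  + by apply: measurable_funD => //; exact: measurable_funM.
  + by move=> r; rewrite addr_ge0// mulr_ge0// ltW.
  by rewrite rpot_resolvent// addeA EFinD -(fineK (finU p)) leeD2r.
- by move=> p; rewrite rpotZ ?(ltW l0)// addeC heat_source_resolvent.
(* With [w] the excess, [f <= g - U] bounds the density by [(l - vn) * (psi + U) + vn * g], hence by
   [l * g + (l - vn) * w]. *)
- move=> p; have H : psi p + U p <= g p + Num.max 0 (psi p + U p - g p).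
    by rewrite -lerBlDl le_max lexx orbT.
  have H0 : 0 <= Num.max 0 (psi p + U p - g p) by rewrite le_max lexx.
  move: H0 H; set w := Num.max _ _ => H0 H.
  have h1 := ler_wpM2l (lvn p) H; have h2 := ler_wpM2l (vn0 p) (fU p).
  have h3 := mulr_ge0 (vn0 p) H0.
  rewrite /zeta1; lra.
Qed.

End duhamel_lower.

(** * Pointwise bounds for the Brownian bridge *)

(* At these times, a particle with drift [b] is within [sqrt s] of distance [a]. *)
Lemma drift_window {R : realType} (a b s t m n : R) : 0 < a -> 0 <= b ->
  m = 1 + a * b -> 0 < n -> n ^+ 2 = m -> 4 * a ^+ 2 <= t ->
  a ^+ 2 / m <= s -> s <= a ^+ 2 / m + a ^+ 2 / n ^+ 3 ->
  [/\ 0 < s, 2 * s <= t, s * m <= 2 * a ^+ 2, s * b <= 2 * a & (a - s * b) ^+ 2 <= s].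
Proof.
move=> a0 b0 mE n0 nm a2t sge sle.
have ab0 : 0 <= a * b by rewrite mulr_ge0// ltW.
have m1 : 1 <= m by rewrite mE lerDl.
have m0 : 0 < m by rewrite (lt_le_trans _ m1).
have n1 : 1 <= n by nra.
have a20 : 0 < a ^+ 2 by rewrite exprn_gt0.
have s0 : 0 < s by rewrite (lt_le_trans _ sge)// divr_gt0.
have n30 : 0 < n ^+ 3 by rewrite exprn_gt0.
have mn3 : m <= n ^+ 3 by rewrite exprS nm ler_peMl// ltW.
have abm : a * b <= m by rewrite mE lerDr.
have an3 : a ^+ 2 / n ^+ 3 <= a ^+ 2 / m by rewrite ler_pM2l// lef_pV2 ?posrE.
have s2 : s * m <= 2 * a ^+ 2.
  have : s <= 2 * (a ^+ 2 / m) by rewrite mulr_natl mulr2n (le_trans sle)// lerD2l.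
  by rewrite mulrA ler_pdivlMr.
have sa : s <= 2 * a ^+ 2 by apply: le_trans s2; rewrite ler_peMr// ltW.
have sb : s * b <= 2 * a.
  rewrite -(ler_pM2r a0) -[leRHS]mulrA -expr2; apply: le_trans s2.
  by rewrite -mulrA ler_pM2l// mulrC.
split=> //; first lra.
apply: (le_trans _ sge); have an0 : 0 <= a / n by rewrite divr_ge0// ltW.
have -> : a ^+ 2 / m = (a / n) ^+ 2 by rewrite expr_div_n nm.
(* At [s = a ^ 2 / m] the gap [a - s * b] is [a / m <= a / n]; lengthening [s] by up to
   [a ^ 2 / n ^ 3] lowers it by at most [a / n]. *)
suff : `|a - s * b| <= a / n.
  by rewrite -(@real_normK _ (a - s * b)) ?num_real// => h; rewrite lerXn2r ?nnegrE.
rewrite ler_norml; apply/andP; split.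
  rewrite lerNl opprB lerBlDr; have := ler_wpM2r b0 sle.
  have -> : (a ^+ 2 / m + a ^+ 2 / n ^+ 3) * b = a * (a * b / m) + a / n * (a * b / m).
    by rewrite -nm; field; rewrite gt_eqF.
  have abm1 : a * b / m <= 1 by rewrite ler_pdivrMr// mul1r.
  have := ler_wpM2l an0 abm1; have := ler_wpM2l (ltW a0) abm1; lra.
have := ler_wpM2r b0 sge.
have -> : a ^+ 2 / m * b = a - a / m.
  by rewrite mE; field; rewrite -mE gt_eqF.
have : a / m <= a / n by rewrite ler_pM2l// lef_pV2 ?posrE// -nm expr2 ler_peMl// ltW.
by lra.
Qed.

Section bridge_bounds.
Context {R : realType} {d : nat}.
Implicit Types (x y z w v : d.-tuple R) (a b c s t u : R).

Definition scalt c x : d.-tuple R := [tuple c * tnth x i | i < d].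

Lemma sqr_enorm_sub_scalt s w v :
  enorm (subt w (scalt s v)) ^+ 2 =
  enorm w ^+ 2 - 2 * s * dotr w v + s ^+ 2 * enorm v ^+ 2.
Proof.
rewrite sqr_enorm_subt (sqr_enorm w) (sqr_enorm v) /dotr !mulr_sumr -sumrB -big_split/=.
by apply: eq_bigr => i _; rewrite tnth_mktuple; ring.
Qed.

Lemma sqr_enorm_sub_scalt_le s w v :
  enorm (subt w (scalt s v)) ^+ 2 <= 2 * enorm w ^+ 2 + 2 * s ^+ 2 * enorm v ^+ 2.
Proof.
rewrite sqr_enorm_subt (sqr_enorm w) (sqr_enorm v) !mulr_sumr -big_split/=.
apply: ler_sum => i _; rewrite tnth_mktuple -subr_ge0.
rewrite (_ : _ - _ = (tnth w i + s * tnth v i) ^+ 2) ?sqr_ge0//; ring.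
Qed.

(** The mean of the bridge is read as uniform motion with velocity [(y - x) / t]. The factor
    [t / (t - s)] reflects that pinning lowers the variance below that of free motion. *)
Lemma gauss_bridge_drift s t x y z : 0 < s -> s < t ->
  gauss s x z * gauss (t - s) z y = gauss t x y *
  ((Num.sqrt (4 * pi * (s * (t - s) / t)))^-1 ^+ d *
   expR (- (t / (t - s) *
     (enorm (subt (subt z x) (scalt s (scalt t^-1 (subt y x)))) ^+ 2 / (4 * s))))).
Proof.
move=> s0 st; have t0 := lt_trans s0 st.
have ts0 : 0 < t - s by rewrite subr_gt0.
rewrite gauss_bridge// addrC subrK; congr (_ * _); rewrite gaussE; last first.
  by rewrite divr_gt0 ?mulr_gt0.
rewrite (_ : enorm (subt z (segt x y (s / t))) =
  enorm (subt (subt z x) (scalt s (scalt t^-1 (subt y x))))); last first.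
  congr enorm; apply: eq_from_tnth => i; rewrite !tnth_mktuple; ring.
congr (_ * expR (- _)); field.
by rewrite !gt_eqF.
Qed.

(** For [3 <= d] the truncated difference [d - 3] is exact, and the real power is a natural power of
    a square root. *)
Lemma KkerE w v : (3 <= d)%N -> Kker w v =
  expR (- ((enorm w * enorm v - dotr w v) / 2)) / enorm w ^+ (d - 2) *
  Num.sqrt (1 + enorm w * enorm v) ^+ (d - 3).
Proof.
move=> d3; rewrite /Kker; congr (_ * _).
have -> : d%:R / 2 - 3 / 2 = (d - 3)%:R / 2 :> R by rewrite natrB// mulrBl.
by rewrite powR_half// addr_ge0// mulr_ge0 ?enorm_ge0.
Qed.

Lemma Kker_ge0 w v : 0 <= Kker w v.
Proof. by rewrite /Kker mulr_ge0 ?powR_ge0// divr_ge0 ?expR_ge0// exprn_ge0// enorm_ge0. Qed.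

Lemma measurable_Kker d' (T : measurableType d') (f : T -> d.-tuple R) v :
  measurable_fun setT f -> measurable_fun setT (fun p => Kker (f p) v).
Proof.
move=> mf; have me := measurable_enorm _ _ _ mf.
have mev : measurable_fun setT (fun p => enorm (f p) * enorm v) by exact: measurable_funM.
apply: measurable_funM.
  apply: measurable_funM.
    apply: (measurableT_comp (@measurable_expR R)).
    apply: (measurableT_comp (@oppr_measurable R setT)); apply: measurable_funM => //.
    apply: measurable_funB => //; apply: measurable_sum => i; apply: measurable_funM => //.
    exact: (measurableT_comp (@measurable_tnth _ R d i) mf).
  by apply: (measurableT_comp measurable_invr); exact: measurable_funX.
by apply: (measurableT_comp (@measurable_powR R _)); exact: measurable_funD.
Qed.

Section lower.
Variables (x y z : d.-tuple R) (t s : R).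
Let w := subt z x.
Let v := scalt t^-1 (subt y x).
Let a := enorm w.
Let b := enorm v.
Let m := 1 + a * b.
Let n := Num.sqrt m.
Hypotheses (a0 : 0 < a) (a2t : 4 * a ^+ 2 <= t) (d3 : (3 <= d)%N).
Hypotheses (sge : a ^+ 2 / m <= s) (sle : s <= a ^+ 2 / m + a ^+ 2 / n ^+ 3).

(** In the window of [drift_window] the standard deviation of the bridge is at most of order
    [a / n], and its exponent exceeds the angular part [(a b - w.v) / 2] by at most 3/2. The factor
    [n ^ 3 / a ^ 2], the inverse length of the window, completes [Kker] to the angular exponential
    times [(n / a) ^ d]. *)
Lemma bridge_ge : gauss t x y * Kker w v * (n ^+ 3 / a ^+ 2) <=
  expR (3 / 2) * Num.sqrt (8 * pi) ^+ d * (gauss s x z * gauss (t - s) z y).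
Proof.
have b0 : 0 <= b by exact: enorm_ge0.
have m0 : 0 < m by rewrite ltr_pwDl// mulr_ge0// ltW.
have n0 : 0 < n by rewrite sqrtr_gt0.
have nm : n ^+ 2 = m by rewrite sqr_sqrtr// ltW.
have a20 : 0 < a ^+ 2 by rewrite exprn_gt0.
have [s0 st2 s2 sb asb] := drift_window a b s t m n a0 b0 erefl n0 nm a2t sge sle.
have t0 : 0 < t by rewrite (lt_le_trans _ st2)// mulr_gt0.
have ts0 : 0 < t - s by rewrite subr_gt0 (lt_le_trans _ st2)// ltr_pMl// ltr1n.
have st : s < t by rewrite -subr_gt0.
have D := sqr_enorm_sub_scalt s w v.
have q_le := sqr_enorm_sub_scalt_le s w v.
move: D q_le; rewrite -/a -/b; set q := enorm _ ^+ 2 => D q_le.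
have q0 : 0 <= q by exact: sqr_ge0.
have sb0 : 0 <= s * b by rewrite mulr_ge0// ltW.
have q10 : q <= 10 * a ^+ 2 by nra.
rewrite gauss_bridge_drift// KkerE// -/w -/v -/q -/a -/b -/m -/n.
rewrite -[leLHS]mulrA [leRHS]mulrCA ler_pM2l ?gauss_gt0//.
rewrite [leLHS](_ : _ = expR (- ((a * b - dotr w v) / 2)) * (n / a) ^+ d); last first.
  have nd : n ^+ d = n ^+ (d - 3) * n ^+ 3 by rewrite -exprD subnK.
  have ad : a ^+ d = a ^+ (d - 2) * a ^+ 2 by rewrite -exprD subnK// ltnW.
  have A0 : a ^+ (d - 2) != 0 by rewrite expf_neq0// gt_eqF.
  rewrite expr_div_n nd ad; move: A0; move: (a ^+ (d - 2)) (n ^+ (d - 3)) => A N A0.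
  by field; rewrite A0 gt_eqF.
rewrite [leRHS](_ : _ = (expR (3 / 2) * expR (- (t / (t - s) * (q / (4 * s))))) *
  (Num.sqrt (8 * pi) / Num.sqrt (4 * pi * (s * (t - s) / t))) ^+ d); last first.
  by rewrite expr_div_n exprVn; ring.
apply: ler_pM; rewrite ?expR_ge0 ?exprn_ge0 ?divr_ge0 ?(ltW a0) ?(ltW n0)//.
  rewrite -expRD ler_expR.
  (* The 3/2 is the sum of 1/4, from [(a - s b) ^ 2 <= s], and 5/4, from [q <= 10 a ^ 2] and
     [t - s >= 2 a ^ 2]. *)
  have -> : t / (t - s) * (q / (4 * s)) = q / (4 * s) + q / (4 * (t - s)).
    by field; rewrite !gt_eqF.
  have -> : q / (4 * s) = (a - s * b) ^+ 2 / (4 * s) + (a * b - dotr w v) / 2.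
    by rewrite D; field; rewrite !gt_eqF.
  have : (a - s * b) ^+ 2 / (4 * s) <= 1 / 4 by rewrite ler_pdivrMr ?mulr_gt0//; lra.
  have : q / (4 * (t - s)) <= 5 / 4.
    rewrite ler_pdivrMr ?mulr_gt0// (le_trans q10)//.
    by move: a2t st2; move: (a ^+ 2) => A; lra.
  by lra.
have p0 := pi_gt0 R.
have r0 : 0 < s * (t - s) / t by rewrite divr_gt0 ?mulr_gt0.
have sq0 : 0 < Num.sqrt (4 * pi * (s * (t - s) / t)).
  by rewrite sqrtr_gt0 !mulr_gt0// invr_gt0.
rewrite lerXn2r ?nnegrE ?divr_ge0 ?sqrtr_ge0 ?(ltW a0) ?(ltW n0)//.
rewrite ler_pdivlMr// mulrAC ler_pdivrMr// -(gtr0_norm a0) -sqrtr_sqr.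
rewrite /n -sqrtrM ?(ltW m0)// -sqrtrM ?mulr_ge0 ?(ltW p0)// ler_wsqrtr//.
(* Together with [s * m <= 2 * a ^ 2] this yields the constant [8 * pi]. *)
have : s * (t - s) / t <= s.
  by rewrite ler_pdivrMr// ler_pM2l//; lra.
move=> /(ler_wpM2l (ltW p0)) /(ler_wpM2l (ltW m0)); have := ler_wpM2l (ltW p0) s2.
by lra.
Qed.

End lower.
End bridge_bounds.

(** * Time integrals of the Brownian bridge *)

(** Trades a polynomial times a Gaussian for [1 / (1 + u ^ 2)], whose primitive is [atan]. The
    constant comes from [1 + |u| <= 2 (1 + u ^ 2)] and the Taylor term of order [n + 1] of the
    exponential at [(1 + u ^ 2) / 4]. *)
Lemma expR_sqr_poly_bound {R : realType} (n : nat) : exists2 C : R, 0 <= C &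
  forall u : R, (1 + `|u|) ^+ n * expR (- (u ^+ 2 / 4)) <= C / (1 + u ^+ 2).
Proof.
exists (2 ^+ n * (4 ^+ n.+1 * n.+1`!%:R * expR (1 / 4))).
  by rewrite !mulr_ge0 ?exprn_ge0 ?expR_ge0.
move=> u; have u0 : 0 < 1 + u ^+ 2 by rewrite ltr_pwDl// sqr_ge0.
rewrite ler_pdivlMr// expRN mulrAC ler_pdivrMr ?expR_gt0//.
have h1 : (1 + `|u|) ^+ n <= (2 * (1 + u ^+ 2)) ^+ n.
  rewrite lerXn2r ?nnegrE ?mulr_ge0 ?addr_ge0 ?sqr_ge0//.
  by rewrite -(real_normK (num_real u)); have := sqr_ge0 (`|u| - 1); nra.
have h2 : (1 + u ^+ 2) ^+ n.+1 <= 4 ^+ n.+1 * n.+1`!%:R * expR (1 / 4) * expR (u ^+ 2 / 4).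
  rewrite -mulrA -expRD -mulrDl.
  have y0 : 0 <= (1 + u ^+ 2) / 4 by rewrite divr_ge0// ltW.
  have := expR_ge1Dxn n y0; rewrite expr_div_n => h.
  have f0 : 0 < n.+1`!%:R :> R by rewrite ltr0n fact_gt0.
  have F0 : 0 < 4 ^+ n.+1 * n.+1`!%:R :> R by rewrite mulr_gt0// exprn_gt0.
  rewrite -ler_pdivrMl//; apply: le_trans h.
  rewrite mulrC invfM mulrA ler_wpDl//.
apply: (le_trans (ler_wpM2r (ltW u0) h1)).
rewrite exprMn -!mulrA ler_pM2l ?exprn_gt0// -exprSr.
by move: h2; rewrite -!mulrA.
Qed.

(** * A time profile with an explicit bounded primitive *)

Section hat.
Context {R : realType}.
Implicit Types (a b s T : R).

(* The derivative of [- atan (a / sqrt s - b * sqrt s)]. *)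
Definition hat a b s : R :=
  (a / s + b) / (2 * Num.sqrt s) / (1 + (a / Num.sqrt s - b * Num.sqrt s) ^+ 2).

Lemma hat_ge0 a b s : 0 <= a -> 0 <= b -> 0 < s -> 0 <= hat a b s.
Proof.
move=> a0 b0 s0; rewrite /hat divr_ge0 ?addr_ge0 ?sqr_ge0//.
by rewrite divr_ge0 ?mulr_ge0 ?sqrtr_ge0// addr_ge0// divr_ge0// ltW.
Qed.

Lemma is_derive_hat a b s : 0 < s ->
  is_derive s 1 (fun s => - atan (a / Num.sqrt s - b * Num.sqrt s)) (hat a b s).
Proof.
move=> s0; have n0 : 0 < Num.sqrt s by rewrite sqrtr_gt0.
have dsq := is_derive1_sqrt s0.
have dV : is_derive s 1 (fun s => (Num.sqrt s)^-1)
    (- (Num.sqrt s)^-2 *: (2 * Num.sqrt s)^-1).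
  by apply: is_deriveV; rewrite gt_eqF.
have dI : is_derive s 1 (fun s => a / Num.sqrt s - b * Num.sqrt s)
  (a *: (- (Num.sqrt s)^-2 *: (2 * Num.sqrt s)^-1) - b *: (2 * Num.sqrt s)^-1).
  exact: (is_deriveB (is_deriveZ a dV) (is_deriveZ b dsq)).
have H := is_deriveN (is_derive1_comp (is_derive1_atan _) dI).
apply: (is_derive_eq H).
rewrite /hat; have -> : a / s = a / Num.sqrt s ^+ 2 by rewrite sqr_sqrtr// ltW.
rewrite /GRing.scale /=; move: (Num.sqrt s) n0 => n n0.
have : 1 + (a / n - b * n) ^+ 2 != 0 by rewrite gt_eqF// ltr_pwDl// sqr_ge0.
move: (1 + _) => D D0; field; rewrite D0 gt_eqF//.
Qed.

(** The primitive need not be differentiable at the endpoints, as at [s = 0] for [hat]. The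
    fundamental theorem is applied on closed subintervals that exhaust the open one, and monotone
    convergence concludes. *)
Lemma integral_itvoo_le (F f : R -> R) (p q c : R) : p < q ->
  (forall r, p < r < q -> is_derive r 1 F (f r)) ->
  (forall r, p < r < q -> 0 <= f r) ->
  (forall r, p < r < q -> {for r, continuous f}) ->
  (forall r r', F r' - F r <= c) ->
  (\int[lebesgue_measure]_(r in `]p, q[) (f r)%:E <= c%:E)%E.
Proof.
move=> pq dF f0 cf Fc.
(* A denominator above 2 keeps [p + e n < q - e n], so every subinterval is nondegenerate. *)
pose e (n : nat) := (q - p) / n.+3%:R.
have qp : 0 < q - p by rewrite subr_gt0.
have e0 n : 0 < e n by rewrite divr_gt0.
have e1 n : e n < (q - p) / 2 by rewrite ltr_pM2l// ltf_pV2 ?posrE// ltr_nat.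
pose I n := `[p + e n, q - e n]%classic.
have mI n : measurable (I n) by exact: measurable_itv.
have sub n r : I n r -> p < r < q.
  by rewrite /I /= in_itv/= => /andP[h1 h2]; have := e0 n; lra.
have -> : `]p, q[%classic = \bigcup_n I n.
  apply/seteqP; split => [r|r [n _] /sub]; rewrite /= in_itv//= => /andP[pr rq].
  pose k := Num.truncn ((q - p) / Num.min (r - p) (q - r)).
  have m0 : 0 < Num.min (r - p) (q - r) by rewrite lt_min !subr_gt0 pr.
  have : e k <= Num.min (r - p) (q - r).
    rewrite ler_pdivrMr// mulrC -ler_pdivrMr// ltW// (lt_le_trans (truncnS_gt _))//.
    by rewrite ler_nat -/k ltnW.
  by rewrite le_min => /andP[h1 h2]; exists k => //; rewrite /I/= in_itv/=; lra.
have ndI : {homo I : n m / (n <= m)%N >-> (n <= m)%O}.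
  move=> n m nm; apply/subsetPset => r; rewrite /I /= !in_itv/= => /andP[h1 h2].
  have : e m <= e n by rewrite ler_pM2l// lef_pV2 ?posrE// ler_nat.
  lra.
have cfI n : {within I n, continuous f}.
  apply: continuous_in_subspaceT => r; rewrite inE => /sub; exact: cf.
have mf n : measurable_fun (I n) (EFin \o f).
  by apply/measurable_EFinP; apply: subspace_continuous_measurable_fun.
apply: (cvge_to_le (ge0_nondecreasing_set_cvg_integral (mu := lebesgue_measure) ndI mI mf _)).
  by move=> n r /sub pr; rewrite lee_fin f0.
apply: nearW => n.
have dFn r : p + e n <= r <= q - e n -> is_derive r 1 F (f r).
  by move=> h; apply: dF; apply: (sub n); rewrite /I/= in_itv.
have lt_e : p + e n < q - e n by have := e1 n; lra.
have E := integral_is_derive F f _ _ lt_e dFn (cfI n).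
by rewrite [X in (X <= _)%E]E -EFinB lee_fin.
Qed.

Lemma continuous_hat a b s : 0 < s -> {for s, continuous (hat a b)}.
Proof.
move=> s0; have n0 : 0 < Num.sqrt s by rewrite sqrtr_gt0.
have cs : Num.sqrt r @[r --> s] --> Num.sqrt s by exact: sqrt_continuous.
have ci : r @[r --> s] --> s by exact: cvg_id.
have cu : a / Num.sqrt r - b * Num.sqrt r @[r --> s] --> a / Num.sqrt s - b * Num.sqrt s.
  apply: cvgB; apply: cvgM => //; try exact: cvg_cst.
  by apply: cvgV => //; rewrite gt_eqF.
apply: cvgM.
  apply: cvgM.
    apply: cvgD; last exact: cvg_cst.
    apply: cvgM; first exact: cvg_cst.
    by apply: cvgV => //; rewrite gt_eqF.
  apply: cvgV; first by rewrite gt_eqF// mulr_gt0.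
  by apply: cvgM => //; exact: cvg_cst.
apply: cvgV; first by rewrite gt_eqF// ltr_pwDl// sqr_ge0.
apply: cvgD; first exact: cvg_cst.
rewrite expr2; under eq_cvg do rewrite expr2.
exact: cvgM.
Qed.

Lemma atanB_le (r r' : R) : atan r - atan r' <= pi.
Proof.
have := atan_ltpi2 r; have := atan_gtNpi2 r'; lra.
Qed.

Lemma integral_hat_le a b T : 0 <= a -> 0 <= b -> 0 < T ->
  (\int[lebesgue_measure]_(s in `]0%R, T[) (hat a b s)%:E <= pi%:E)%E.
Proof.
move=> a0 b0 T0.
pose F s := - atan (a / Num.sqrt s - b * Num.sqrt s).
apply (integral_itvoo_le F (hat a b) 0 T pi T0).
- by move=> r /andP[r0 _]; exact: is_derive_hat.
- by move=> r /andP[r0 _]; exact: hat_ge0.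
- by move=> r /andP[r0 _]; exact: continuous_hat.
- by move=> r r'; rewrite opprK addrC atanB_le.
Qed.

(** The time-reversed profile, for the second half of the bridge. *)
Lemma integral_hat_rev_le a b T : 0 <= a -> 0 <= b -> 0 < T ->
  (\int[lebesgue_measure]_(s in `]0%R, T[) (hat a b (T - s)%R)%:E <= pi%:E)%E.
Proof.
move=> a0 b0 T0.
pose F s := - atan (a / Num.sqrt s - b * Num.sqrt s).
have dT (r : R) : is_derive r 1 (fun r => T - r) (- 1).
  apply: (is_derive_eq (is_deriveB (is_derive_cst T r 1) (is_derive_id r 1))).
  exact: sub0r.
apply (integral_itvoo_le (fun s => - F (T - s)) (fun s => hat a b (T - s)) 0 T pi T0).
- move=> r /andP[_ rT].
  have H : is_derive (T - r) 1 F (hat a b (T - r)) by apply: is_derive_hat; rewrite subr_gt0.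
  have H2 := is_deriveN (@is_derive1_comp _ F (fun r => T - r) r _ _ H (dT r)).
  by apply: (is_derive_eq H2); rewrite mulrN1 opprK.
- by move=> r /andP[_ rT]; apply: hat_ge0 => //; rewrite subr_gt0.
- move=> r /andP[_ rT]; apply: (@continuous_comp _ _ _ (fun r => T - r) (hat a b)).
    by apply: cvgB; [exact: cvg_cst|exact: cvg_id].
  by apply: continuous_hat; rewrite subr_gt0.
- by move=> r r'; rewrite !opprK atanB_le.
Qed.

Lemma measurable_hat d' (T' : measurableType d') a b (f : T' -> R) :
  measurable_fun setT f -> measurable_fun setT (fun p => hat a b (f p)).
Proof.
move=> mf; have ms : measurable_fun setT (fun p => Num.sqrt (f p)).
  exact: (measurableT_comp measurable_sqrtr).
have mi (g : T' -> R) : measurable_fun setT g -> measurable_fun setT (fun p => (g p)^-1).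
  by move=> mg; exact: (measurableT_comp measurable_invr).
apply: measurable_funM; last first.
  apply: (mi _); apply: measurable_funD => //; apply: measurable_funX.
  by apply: measurable_funB; apply: measurable_funM => //; exact: (mi _).
apply: measurable_funM; last by apply: (mi _); exact: measurable_funM.
by apply: measurable_funD => //; apply: measurable_funM => //; exact: (mi _).
Qed.

End hat.

(** Put [u = a / sqrt s - b * sqrt s]. Of the [d] factors [1 / sqrt s], three are absorbed by [hat];
    the other [d - 3] are each at most [(1 + |u|) * m / a] with [m = sqrt (1 + a b)], and the
    Gaussian absorbs the powers of [1 + |u|]. *)
Lemma drift_upper {R : realType} (d : nat) (C a b s : R) : (3 <= d)%N ->
  0 < a -> 0 <= b -> 0 < s -> 0 <= C ->
  (forall u : R, (1 + `|u|) ^+ (d - 3) * expR (- (u ^+ 2 / 4)) <= C / (1 + u ^+ 2)) ->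
  (Num.sqrt s)^-1 ^+ d * expR (- ((a / Num.sqrt s - b * Num.sqrt s) ^+ 2 / 4)) <=
  2 * C * (Num.sqrt (1 + a * b) ^+ (d - 3) / a ^+ (d - 2)) * hat a b s.
Proof.
move=> d3 a0 b0 s0 C0 HC.
have n0 : 0 < Num.sqrt s by rewrite sqrtr_gt0.
have ab0 : 0 <= a * b by rewrite mulr_ge0// ltW.
rewrite /hat; have -> : a / s = a / Num.sqrt s ^+ 2 by rewrite sqr_sqrtr// ltW.
have : Num.sqrt (1 + a * b) ^+ 2 = 1 + a * b by rewrite sqr_sqrtr// addr_ge0.
have : 1 <= Num.sqrt (1 + a * b) by rewrite -[leLHS]sqrtr1 ler_wsqrtr// lerDl.
move: (Num.sqrt (1 + a * b)) => m m1 mE.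
have := HC (a / Num.sqrt s - b * Num.sqrt s).
move: (Num.sqrt s) n0 => n n0; set u := a / n - b * n => {}HC.
have u20 : 0 < 1 + u ^+ 2 by rewrite ltr_pwDl// sqr_ge0.
(* The product of [a / n] and [b * n] is [m ^ 2 - 1]. If the first exceeds [m], the second is below
   [m], and [a / n = u + b * n]. *)
have an : a / n <= (1 + `|u|) * m.
  have [anm|man] := leP (a / n) m; first by have := normr_ge0 u; nra.
  have bnm : b * n <= m.
    have : (a / n) * (b * n) = m ^+ 2 - 1 by rewrite mE; field; rewrite gt_eqF.
    have : 0 <= b * n by rewrite mulr_ge0// ltW.
    nra.
  have := ler_norm u; have := normr_ge0 u; rewrite {2 3}/u; nra.
have V : n^-1 <= (1 + `|u|) * (m / a).
  by rewrite mulrA ler_pdivlMr// mulrC.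
have V0 : 0 <= n^-1 by rewrite invr_ge0 ltW.
have -> : n^-1 ^+ d = n^-1 ^+ (d - 3) * n^-1 ^+ 3 by rewrite -exprD subnK.
have -> : a ^+ (d - 2) = a ^+ (d - 3) * a by rewrite -exprSr -subSn// subSS.
apply: (@le_trans _ _ (((1 + `|u|) * (m / a)) ^+ (d - 3) * n^-1 ^+ 3 * expR (- (u ^+ 2 / 4)))).
  rewrite ler_wpM2r ?expR_ge0// ler_wpM2r ?exprn_ge0// lerXn2r ?nnegrE//.
  exact: le_trans V.
rewrite exprMn [leLHS](_ : _ = (m / a) ^+ (d - 3) * n^-1 ^+ 3 *
  ((1 + `|u|) ^+ (d - 3) * expR (- (u ^+ 2 / 4)))); last by ring.
have ma0 : 0 <= (m / a) ^+ (d - 3).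
  by rewrite exprn_ge0// divr_ge0 ?(ltW a0)// (le_trans _ m1).
have ma : 0 <= (m / a) ^+ (d - 3) * n^-1 ^+ 3 by rewrite mulr_ge0// exprn_ge0.
apply: (le_trans (ler_wpM2l ma HC)).
have A0 : a ^+ (d - 3) != 0 by rewrite expf_neq0// gt_eqF.
rewrite expr_div_n in ma0 *; rewrite -subr_ge0.
have -> : 2 * C * (m ^+ (d - 3) / (a ^+ (d - 3) * a)) *
    ((a / n ^+ 2 + b) / (2 * n) / (1 + u ^+ 2)) -
    m ^+ (d - 3) / a ^+ (d - 3) * n^-1 ^+ 3 * (C / (1 + u ^+ 2)) =
    (m ^+ (d - 3) / a ^+ (d - 3)) * (C * b / (a * n * (1 + u ^+ 2))).
  move: A0 (u20); move: (a ^+ (d - 3)) (m ^+ (d - 3)) (1 + u ^+ 2) => A M U A0 U0.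
  by field; rewrite A0 !gt_eqF.
by rewrite mulr_ge0// divr_ge0 ?mulr_ge0// ltW.
Qed.

Lemma integral_le_lincomb {R : realType} (D : set (measurableTypeR R))
    (F h1 h2 : measurableTypeR R -> R) (A1 A2 c1 c2 : R) :
  measurable D -> measurable_fun setT F -> measurable_fun setT h1 -> measurable_fun setT h2 ->
  0 <= A1 -> 0 <= A2 -> (forall s, 0 <= F s) ->
  (forall s, D s -> 0 <= h1 s) -> (forall s, D s -> 0 <= h2 s) ->
  (forall s, D s -> F s <= A1 * h1 s + A2 * h2 s) ->
  (\int[lebesgue_measure]_(s in D) (h1 s)%:E <= c1%:E)%E ->
  (\int[lebesgue_measure]_(s in D) (h2 s)%:E <= c2%:E)%E ->
  (\int[lebesgue_measure]_(s in D) (F s)%:E <= (A1 * c1 + A2 * c2)%:E)%E.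
Proof.
move=> mD mF mh1 mh2 A10 A20 F0 h10 h20 Fle i1 i2.
have me (h : measurableTypeR R -> R) : measurable_fun setT h ->
      measurable_fun D (fun s => (h s)%:E).
  by move=> mh; apply: measurable_funTS; exact/measurable_EFinP.
have e1 s : D s -> (0 <= (h1 s)%:E)%E by move=> /h10; rewrite lee_fin.
have e2 s : D s -> (0 <= (h2 s)%:E)%E by move=> /h20; rewrite lee_fin.
apply: (@le_trans _ _ (\int[lebesgue_measure]_(s in D)
    (A1%:E * (h1 s)%:E + A2%:E * (h2 s)%:E))%E).
  have Fe s : D s -> (0 <= (F s)%:E)%E by rewrite lee_fin F0.
  have mS : measurable_fun D (fun s => A1%:E * (h1 s)%:E + A2%:E * (h2 s)%:E)%E.
    by apply: emeasurable_funD; apply: emeasurable_funM => //; exact: me.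
  apply: (ge0_le_integral _ mD Fe (me _ mF) mS) => s Ds.
  by rewrite -!EFinM -EFinD lee_fin Fle.
have f10 s : D s -> (0 <= A1%:E * (h1 s)%:E)%E by move=> Ds; rewrite mule_ge0 ?e1.
have f20 s : D s -> (0 <= A2%:E * (h2 s)%:E)%E by move=> Ds; rewrite mule_ge0 ?e2.
rewrite (ge0_integralD _ mD f10 (emeasurable_funM _ (me _ mh1))
  f20 (emeasurable_funM _ (me _ mh2)))//.
rewrite (ge0_integralZl_EFin _ mD e1 (me _ mh1) A10) (ge0_integralZl_EFin _ mD e2 (me _ mh2) A20).
by rewrite EFinD !EFinM leeD// lee_wpmul2l.
Qed.

Section bridge_integrals.
Context {R : realType} {d : nat}.
Hypothesis d3 : (3 <= d)%N.
Implicit Types (x y z w v : d.-tuple R) (a b c s t u : R).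

(** For [2 * s <= t] the bridge variance is at least half that of free motion. The identity [|w - s
    v| ^ 2 = (a - s b) ^ 2 + 2 s (a b - w.v)] splits off the exponential of K, and [drift_upper]
    treats the radial rest. *)
Lemma bridge_le : exists2 C : R, 0 <= C & forall x y z t s,
  0 < enorm (subt z x) -> 0 < s -> 2 * s <= t ->
  gauss s x z * gauss (t - s) z y <=
  C * (gauss t x y * Kker (subt z x) (scalt t^-1 (subt y x))) *
  hat (enorm (subt z x)) (enorm (scalt t^-1 (subt y x))) s.
Proof.
have [C C0 HC] := @expR_sqr_poly_bound R (d - 3).
exists (2 * C); first exact: mulr_ge0.
move=> x y z t s; set w := subt z x; set v := scalt _ _ => a0 s0 st2.
have st : s < t by lra.
have t0 : 0 < t by lra.
have ts0 : 0 < t - s by lra.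
rewrite gauss_bridge_drift// -/w -/v KkerE//.
set a := enorm w; set b := enorm v.
have b0 : 0 <= b by exact: enorm_ge0.
have := drift_upper d C a b s d3 a0 b0 s0 C0 HC.
set h := hat a b s; set e := expR (- (_ / 4)) => H.
rewrite [leRHS](_ : _ = gauss t x y * (expR (- ((a * b - dotr w v) / 2)) *
  (2 * C * (Num.sqrt (1 + a * b) ^+ (d - 3) / a ^+ (d - 2)) * h))); last by ring.
rewrite ler_wpM2l ?gauss_ge0//.
apply: le_trans (ler_wpM2l (expR_ge0 _) H).
rewrite [leRHS]mulrCA ler_pM ?expR_ge0 ?exprn_ge0 ?invr_ge0 ?sqrtr_ge0//.
  have p2 := pi_ge2 R.
  have r0 : s <= 4 * pi * (s * (t - s) / t).
    have : s / 2 <= s * (t - s) / t.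
      rewrite ler_pdivlMr//; have := mulr_ge0 (ltW s0) (_ : 0 <= t - 2 * s).
      by rewrite subr_ge0 => /(_ st2); lra.
    by nra.
  rewrite lerXn2r ?nnegrE ?invr_ge0 ?sqrtr_ge0//.
  by rewrite lef_pV2 ?posrE ?sqrtr_gt0 ?ler_wsqrtr// (lt_le_trans s0).
rewrite -expRD ler_expR -opprD lerN2.
have D := sqr_enorm_sub_scalt s w v.
have q0 := sqr_ge0 (enorm (subt w (scalt s v))).
rewrite -/a -/b in D.
have -> : (a / Num.sqrt s - b * Num.sqrt s) ^+ 2 = (a - s * b) ^+ 2 / s.
  have n0 : 0 < Num.sqrt s by rewrite sqrtr_gt0.
  rewrite -{3 4}(sqr_sqrtr (ltW s0)); field; by rewrite gt_eqF.
apply: (@le_trans _ _ (enorm (subt w (scalt s v)) ^+ 2 / (4 * s))).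
  rewrite D le_eqVlt; apply/orP; left; apply/eqP; field; by rewrite gt_eqF.
rewrite ler_peMl//.
  by rewrite divr_ge0// mulr_ge0// ltW.
by rewrite ler_pdivlMr// mul1r gerBl ltW.
Qed.

Lemma measurable_bridge x y z t :
  measurable_fun setT (fun s => gauss s x z * gauss (t - s) z y).
Proof.
apply: measurable_funM; first exact: measurable_gauss.
by apply: measurable_gauss => //; exact: measurable_funB.
Qed.

(** Times after [t / 2] are reached by running the bridge backwards from [y] to [x], whence the
    second K. Each profile [hat] contributes at most [pi]. *)
Lemma integral_bridge_le : exists2 C : R, 0 <= C & forall x y z t,
  0 < enorm (subt z x) -> 0 < enorm (subt z y) -> 0 < t ->
  (\int[lebesgue_measure]_(s in `]0%R, t[) (gauss s x z * gauss (t - s)%R z y)%:E <=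
  (C * gauss t x y * (Kker (subt z x) (scalt t^-1 (subt y x)) +
                      Kker (subt z y) (scalt t^-1 (subt x y))))%:E)%E.
Proof.
have [C C0 HC] := bridge_le; exists (C * pi); first by rewrite mulr_ge0// pi_ge0.
move=> x y z t zx zy t0.
set K1 := Kker (subt z x) _; set K2 := Kker (subt z y) _.
have K10 : 0 <= K1 by exact: Kker_ge0.
have K20 : 0 <= K2 by exact: Kker_ge0.
have g0 := gauss_ge0 t x y.
pose h1 s := hat (enorm (subt z x)) (enorm (scalt t^-1 (subt y x))) s.
pose h2 s := hat (enorm (subt z y)) (enorm (scalt t^-1 (subt x y))) (t - s).
have h10 s : 0 < s -> 0 <= h1 s by apply: hat_ge0; exact: enorm_ge0.
have h20 s : s < t -> 0 <= h2 s.
  by move=> st; apply: hat_ge0; rewrite ?enorm_ge0// subr_gt0.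
have mh1 : measurable_fun setT h1 by exact: measurable_hat.
have mh2 : measurable_fun setT h2 by apply: measurable_hat; exact: measurable_funB.
have -> : C * pi * gauss t x y * (K1 + K2) =
    C * (gauss t x y * K1) * pi + C * (gauss t x y * K2) * pi.
  by move: pi (K1) (K2) => p k1 k2; ring.
have g1 : 0 <= C * (gauss t x y * K1) by exact: mulr_ge0 C0 (mulr_ge0 g0 K10).
have g2 : 0 <= C * (gauss t x y * K2) by exact: mulr_ge0 C0 (mulr_ge0 g0 K20).
have i1 := integral_hat_le _ _ _ (enorm_ge0 (subt z x)) (enorm_ge0 (scalt t^-1 (subt y x))) t0.
have i2 := integral_hat_rev_le _ _ _ (enorm_ge0 (subt z y)) (enorm_ge0 (scalt t^-1 (subt x y))) t0.
have bound s : 0 < s -> s < t -> gauss s x z * gauss (t - s) z y <=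
    C * (gauss t x y * K1) * h1 s + C * (gauss t x y * K2) * h2 s.
  move=> s0 st; have [st2|ts2] := leP (2 * s) t.
    apply: (le_trans (HC x y z t s zx s0 st2)); rewrite lerDl.
    exact: mulr_ge0 g2 (h20 s st).
  have ts0 : 0 < t - s by rewrite subr_gt0.
  have ts' : 2 * (t - s) <= t by lra.
  have := HC y x z t (t - s) zy ts0 ts'; rewrite subKr (gaussC t y x) => h.
  rewrite mulrC (gaussC _ z y) (gaussC _ x z) (le_trans h)// lerDr.
  exact: mulr_ge0 g1 (h10 s s0).
have mI : measurable (`]0, t[%classic : set R) by exact: measurable_itv.
have F0 s : 0 <= gauss s x z * gauss (t - s) z y by rewrite mulr_ge0 ?gauss_ge0.
have p1 s : (`]0, t[%classic : set R) s -> 0 <= h1 s.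
  by rewrite /= in_itv/= => /andP[s0 _]; exact: h10.
have p2 s : (`]0, t[%classic : set R) s -> 0 <= h2 s.
  by rewrite /= in_itv/= => /andP[_ st]; exact: h20.
have p12 s : (`]0, t[%classic : set R) s -> gauss s x z * gauss (t - s) z y <=
    C * (gauss t x y * K1) * h1 s + C * (gauss t x y * K2) * h2 s.
  by rewrite /= in_itv/= => /andP[s0 st]; exact: bound.
exact (integral_le_lincomb _ _ h1 h2 _ _ _ _ mI (measurable_bridge x y z t)
  mh1 mh2 g1 g2 F0 p1 p2 p12 i1 i2).
Qed.

(** The integral is restricted to the window of [drift_window], whose length cancels the factor
    [n ^ 3 / a ^ 2] of [bridge_ge]. *)
Lemma integral_bridge_ge : exists2 C : R, 0 <= C & forall x y z t,
  4 * enorm (subt z x) ^+ 2 <= t -> 0 < t ->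
  ((gauss t x y * Kker (subt z x) (scalt t^-1 (subt y x)))%:E <= C%:E *
   \int[lebesgue_measure]_(s in `]0%R, t[) (gauss s x z * gauss (t - s)%R z y)%:E)%E.
Proof.
exists (expR (3 / 2) * Num.sqrt (8 * pi) ^+ d).
  by rewrite mulr_ge0 ?expR_ge0// exprn_ge0// sqrtr_ge0.
set C := _ * _; have C0 : 0 <= C by rewrite mulr_ge0 ?expR_ge0// exprn_ge0// sqrtr_ge0.
move=> x y z t a2t t0; set w := subt z x; set v := scalt _ _.
have I0 s : (0 <= (gauss s x z * gauss (t - s) z y)%:E)%E.
  by rewrite lee_fin mulr_ge0 ?gauss_ge0.
have := enorm_ge0 w; rewrite le_eqVlt => /orP[/eqP w0|a0].
  (* At [z = x] the division by [0 ^ (d - 2) = 0] gives [Kker] the value 0. *)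
  rewrite KkerE// -w0 [X in _ / X]expr0n subn_eq0 leqNgt d3 /= invr0 mulr0 mul0r mulr0.
  by rewrite mule_ge0 ?lee_fin//; exact: integral_ge0.
set a := enorm w in a0; pose b := enorm v; pose m := 1 + a * b; pose n := Num.sqrt m.
have b0 : 0 <= b by exact: enorm_ge0.
have m0 : 0 < m by rewrite ltr_pwDl// mulr_ge0// ltW.
have n0 : 0 < n by rewrite sqrtr_gt0.
have nm : n ^+ 2 = m by rewrite sqr_sqrtr// ltW.
pose I := `[a ^+ 2 / m, a ^+ 2 / m + a ^+ 2 / n ^+ 3]%classic.
have l0 : 0 < a ^+ 2 / n ^+ 3 by rewrite divr_gt0 ?exprn_gt0.
have sub : I `<=` `]0, t[%classic.
  move=> s; rewrite /I /= !in_itv/= => /andP[h1 h2].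
  have [s0 st2 _ _ _] := drift_window a b s t m n a0 b0 erefl n0 nm a2t h1 h2.
  by rewrite s0/=; lra.
have mb : measurable_fun setT (fun s => (gauss s x z * gauss (t - s) z y)%:E).
  by apply/measurable_EFinP; exact: measurable_bridge.
apply: (@le_trans _ _ (C%:E * \int[lebesgue_measure]_(s in I)
    (gauss s x z * gauss (t - s)%R z y)%:E)%E); last first.
  rewrite lee_wpmul2l ?lee_fin//; apply: ge0_subset_integral => //; first exact: measurable_itv.
  exact: (measurable_funTS mb).
have mI : measurable I by exact: measurable_itv.
rewrite -ge0_integralZl_EFin//=; last exact: (measurable_funTS mb).
apply: (@le_trans _ _ (\int[lebesgue_measure]_(s in I)
    (cst (gauss t x y * Kker w v * (n ^+ 3 / a ^+ 2))%:E s))%E); last first.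
  apply: ge0_le_integral => //=.
  - move=> s _; rewrite lee_fin mulr_ge0 ?divr_ge0 ?exprn_ge0 ?(ltW n0) ?(ltW a0)//.
    by rewrite mulr_ge0 ?gauss_ge0 ?Kker_ge0.
  - by apply: (measurable_funTS (emeasurable_funM _ mb)).
  - move=> s; rewrite /I/= in_itv/= => /andP[h1 h2].
    by rewrite -EFinM lee_fin; exact: bridge_ge.
rewrite integral_cst// /= /I lebesgue_measure_itv/= lte_fin ltrDl l0.
rewrite -EFinB addrAC subrr add0r -EFinM lee_fin.
rewrite le_eqVlt; apply/orP; left; apply/eqP; field.
by rewrite !gt_eqF.
Qed.

End bridge_integrals.

(** * Boundedness of the potential and of K *)

Section fundamental.
Context {R : realType} {d : nat}.
Local Notation X := (measurableTypeR R * d.-tuple R)%type.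
Implicit Types (x y z : d.-tuple R) (V : d.-tuple R -> R).

(** Tonelli puts the time integral inside, where the bridge bounds apply. *)
Lemma rpot_heat_source V x (t : R) y : measurable_fun setT V ->
  (rpot 0%R (fun p : X => (`|V p.2| * heat_source x p)%R) (t, y) =
   \int[lebesgue_tuple d]_z (`|V z|%:E *
     \int[lebesgue_measure]_(s in `]0%R, t[) (gauss s x z * gauss (t - s)%R z y)%:E))%E.
Proof.
move=> mV.
have mnV : measurable_fun setT (fun z => `|V z|) by exact: (measurableT_comp _ mV).
have mnV2 : measurable_fun setT (fun p : X => `|V p.2|).
  exact: (measurableT_comp mnV).
pose F (p : X) : \bar R := ((heatk 0 p (t, y))%:E * (`|V p.2| * heat_source x p)%:E)%E.
have mF : measurable_fun setT F.
  apply: measurable_heatk_mul; apply/measurable_EFinP; apply: measurable_funM => //.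
  exact: measurable_heat_source.
have F0 p : (0 <= F p)%E.
  by rewrite mule_ge0 ?lee_fin ?heatk_ge0// mulr_ge0// heat_source_ge0.
transitivity (\int[lebesgue_tuple d]_z \int[lebesgue_measure]_s F (s, z))%E.
  exact: (fubini_tonelli2 (m1 := @lebesgue_measure R) F mF F0).
apply: eq_integral => z _.
rewrite -ge0_integralZl_EFin//=; last 2 first.
- by move=> s _; rewrite lee_fin mulr_ge0 ?gauss_ge0.
- by apply: measurable_funTS; apply/measurable_EFinP; exact: measurable_bridge.
rewrite [RHS]integral_mkcond; apply: eq_integral => s _; rewrite patchE /F /=.
case: ifPn => [|/negP]; rewrite inE /= in_itv/=.
  move=> /andP[s0 st]; rewrite -!EFinM heat_source_gauss// /heatk /= st; congr EFin.
  by rewrite mul0r oppr0 expR0; ring.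
move/negP; rewrite negb_and -!leNgt => /orP[s0|ts].
  by rewrite /heat_source (heatk_eq0 _ _ (s, z))// mulr0 mule0.
by rewrite (heatk_eq0 _ (s, z))// mul0e.
Qed.

(** The definition gives measurability of the Duhamel integrand only, not of [G]. So [f] is defined
    by the right-hand side of the Duhamel formula, which is measurable by construction, and is
    identified with [G] at positive times afterwards. *)
Lemma fundamental_solution_rpot V (G : R -> d.-tuple R -> d.-tuple R -> R) x :
  measurable_fun setT V -> (forall z, V z <= 0) -> fundamental_solution V G ->
  let v := fun p : X => `|V p.2| in
  exists2 f : X -> R, (forall (t : R) y, 0 < t -> f (t, y) = G t x y) &
  [/\ measurable_fun setT f, forall p, p.1 <= 0 -> f p = 0,
    (forall q, rpot 0%R (fun p => (v p * Num.max 0 (f p))%R) q \is a fin_num),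
    (forall q, rpot 0%R (fun p => (v p * Num.max 0 (- f p))%R) q \is a fin_num) &
    forall q, f q = heat_source x q
      + fine (rpot 0 (fun p => v p * Num.max 0 (- f p)) q)
      - fine (rpot 0 (fun p => v p * Num.max 0 (f p)) q)].
Proof.
move=> mV V0 hG v.
pose H (p : X) : R := if 0 < p.1 then G p.1 x p.2 * V p.2 else 0.
have HV (t : R) z : 0 < t -> H (t, z) = G t x z * V z by rewrite /H /= => ->.
pose D (t : R) : set X := `]0, t[%classic `*` setT.
have mD t : measurable (D t) by apply: measurableX => //; exact: measurable_itv.
have HD (t : R) y : 0 < t -> (fun p : X => (heatk 0 p (t, y) * H p)%:E) =
    ((fun p : X => (G p.1 x p.2 * V p.2 * gauss (t - p.1) p.2 y)%:E) \_ (D t)).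
  move=> t0; apply/funext => -[s z]; rewrite patchE.
  case: ifPn => [|/negP]; rewrite inE /D /= in_itv/=.
    move=> [/andP[s0 st] _]; rewrite HV// /heatk /= st; congr EFin.
    by rewrite mul0r oppr0 expR0; ring.
  move=> h; have [ts|st] := leP t s; first by rewrite (heatk_eq0 _ (s, z))// mul0r.
  rewrite /H /=; case: ltP => s0; last by rewrite mulr0.
  by exfalso; apply: h; rewrite s0 st.
have iH (t : R) y : 0 < t ->
    (@spacetime R d).-integrable setT (fun p : X => (heatk 0 p (t, y) * H p)%:E).
  move=> t0; rewrite HD//; apply/integrable_restrict => //.
  by rewrite setTI; have [] := hG t x y t0.
have mH : measurable_fun setT H.
  (* Dividing the integrand by the positive kernel towards time [n + 1] recovers [H] at all earlier
     times. *)
  pose h (n : nat) (p : X) := heatk 0 p (n.+1%:R, x) * H p / heatk 0 p (n.+1%:R, x).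
  apply: (measurable_fun_cvg (h := h)) => [n|p _].
    apply: measurable_funM.
      by have /measurable_int/measurable_EFinP := iH n.+1%:R x (ltr0Sn _ _).
    by apply: (measurableT_comp measurable_invr); exact: measurable_heatk.
  apply: cvg_near_cst; exists (Num.truncn p.1) => // n /= pn.
  have pn1 : p.1 < n.+1%:R by rewrite (lt_le_trans (truncnS_gt _))// ler_nat.
  by rewrite /h mulrAC mulfV ?mul1r// gt_eqF// heatk0_gt0.
(* As [V <= 0], [H] is [- v * f]: its negative part is the density [v * f^+] and its positive part
   is [v * f^-]. *)
pose Pp (p : X) := Num.max 0 (- H p); pose Nn (p : X) := Num.max 0 (H p).
have Pp0 p : 0 <= Pp p by rewrite le_max lexx.
have Nn0 p : 0 <= Nn p by rewrite le_max lexx.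
have mPp : measurable_fun setT Pp.
  by apply: measurable_maxr => //; exact: (measurableT_comp (@oppr_measurable R setT)).
have mNn : measurable_fun setT Nn by exact: measurable_maxr.
have kH l q : measurable_fun setT (fun p => (heatk l p q)%:E * (Pp p)%:E)%E.
  by apply: measurable_heatk_mul; exact/measurable_EFinP.
have split (t : R) y : 0 < t -> [/\ rpot 0 Pp (t, y) \is a fin_num,
    rpot 0 Nn (t, y) \is a fin_num &
    (\int[@spacetime R d]_p (heatk 0 p (t, y) * H p)%:E =
     rpot 0 Nn (t, y) - rpot 0 Pp (t, y))%E].
  move=> t0; have iHt := iH t y t0.
  have EN : (rpot 0 Nn (t, y) =
      \int[@spacetime R d]_p (fun p : X => (heatk 0 p (t, y) * H p)%:E)^\+ p)%E.
    apply: eq_integral => p _; rewrite funeposE -EFinM -EFin_max; congr EFin.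
    by rewrite /Nn maxr_pMr ?heatk_ge0// mulr0 maxC.
  have EP : (rpot 0 Pp (t, y) =
      \int[@spacetime R d]_p (fun p : X => (heatk 0 p (t, y) * H p)%:E)^\- p)%E.
    apply: eq_integral => p _; rewrite funenegE -EFinM -EFinN -EFin_max; congr EFin.
    by rewrite /Pp maxr_pMr ?heatk_ge0// mulr0 mulrN maxC.
  split; last by rewrite EN EP -integralE.
  - by rewrite EP; exact: (integrable_neg_fin_num measurableT iHt).
  - by rewrite EN; exact: (integrable_pos_fin_num measurableT iHt).
have neg h (q : X) : q.1 <= 0 -> (forall p, 0 <= h p) ->
    (forall p, p.1 <= 0 -> h p = 0) -> rpot 0 h q = 0%E.
  move=> q0 h0 hn; apply: integral0_eq => p _.
  have [p0|p0] := leP p.1 0; first by rewrite hn// mule0.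
  by rewrite heatk_eq0 ?mul0e// (le_trans q0)// ltW.
have Ppn p : p.1 <= 0 -> Pp p = 0 by move=> p0; rewrite /Pp /H ltNge p0 oppr0 maxxx.
have Nnn p : p.1 <= 0 -> Nn p = 0 by move=> p0; rewrite /Nn /H ltNge p0 maxxx.
have finP q : rpot 0 Pp q \is a fin_num.
  case: q => t y; have [t0|t0] := leP t 0; first by rewrite neg.
  by have [] := split t y t0.
have finN q : rpot 0 Nn q \is a fin_num.
  case: q => t y; have [t0|t0] := leP t 0; first by rewrite neg.
  by have [] := split t y t0.
pose f q := heat_source x q + fine (rpot 0 Nn q) - fine (rpot 0 Pp q).
have fneg q : q.1 <= 0 -> f q = 0.
  by move=> q0; rewrite /f !neg//= /heat_source heatk_eq0// addr0 subr0.
have fG (t : R) y : 0 < t -> f (t, y) = G t x y.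
  move=> t0; have [_ duh] := hG t x y t0; apply: EFin_inj; rewrite duh.
  have [fP fN E] := split t y t0.
  rewrite /f heat_source_gauss// -addrA EFinD EFinB !fineK// -E; congr (_ + _)%E.
  rewrite -(integral12_prod_meas1 (m1 := @lebesgue_measure R) (m2 := lebesgue_tuple d) (iH t y t0)).
  rewrite [RHS]integral_mkcond; apply: eq_integral => s _; rewrite patchE /fubini_F.
  have HDt z := congr1 (fun F => F (s, z)) (HD t y t0).
  case: ifPn => [|/negP]; rewrite inE /= in_itv/= => sI.
    apply: eq_integral => z _; rewrite HDt patchE ifT//.
    by rewrite inE /D /= in_itv/= sI.
  apply: integral0_eq => z _; rewrite HDt patchE ifF//; apply/negP.
  by rewrite inE /D /= in_itv/= => -[].
have vP p : v p * Num.max 0 (f p) = Pp p.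
  have [p0|p0] := leP p.1 0; first by rewrite fneg// maxxx mulr0 Ppn.
  case: p p0 => t z /= t0; rewrite fG// /Pp HV// /v /= maxr_pMr ?normr_ge0//.
  by rewrite mulr0 ler0_norm// mulNr mulrC.
have vN p : v p * Num.max 0 (- f p) = Nn p.
  have [p0|p0] := leP p.1 0; first by rewrite fneg// oppr0 maxxx mulr0 Nnn.
  case: p p0 => t z /= t0; rewrite fG// /Nn HV// /v /= maxr_pMr ?normr_ge0//.
  by rewrite mulr0 ler0_norm// mulrNN mulrC.
have eP : (fun p => v p * Num.max 0 (f p)) = Pp by apply/funext.
have eN : (fun p => v p * Num.max 0 (- f p)) = Nn by apply/funext.
exists f => //; rewrite eP eN; split => //.
apply: measurable_funB; last exact: measurable_rpot.
by apply: measurable_funD; [exact: measurable_heat_source|exact: measurable_rpot].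
Qed.

End fundamental.

(** * Comparison of the potential of [v * g] with K *)

Section boundedness.
Context {R : realType} {d : nat}.
Hypothesis d3 : (3 <= d)%N.
Local Notation X := (measurableTypeR R * d.-tuple R)%type.
Implicit Types (x y z w : d.-tuple R) (V : d.-tuple R -> R).

Lemma enorm_subt_gt0 x z : z <> x -> 0 < enorm (subt z x).
Proof.
move=> zx; rewrite lt_neqAle enorm_ge0 andbT eq_sym; apply/eqP => e0; apply: zx.
have := sqr_enorm_subt z x; rewrite e0 expr0n /= => /esym/eqP.
rewrite psumr_eq0 => [/allP h|i _]; last exact: sqr_ge0.
apply: eq_from_tnth => i; have := h i (mem_index_enum _).
by rewrite sqrf_eq0 subr_eq0 => /eqP.
Qed.

Lemma lebesgue_tuple_set1 x : lebesgue_tuple d [set x] = 0%E.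
Proof.
have -> : [set x] = [set z | forall i, [set tnth x i] (tnth z i)].
  by apply/seteqP; split => [z /= -> //|z /= h]; apply: eq_from_tnth.
rewrite (@lebesgue_tuple_box R d (fun i => [set tnth x i])) => [|i]; last exact: measurable_set1.
have d0 : (0 < d)%N by rewrite (leq_trans _ d3).
by rewrite (bigD1 (Ordinal d0))//= lebesgue_measure_set1 mul0e.
Qed.

Lemma measurable_tuple_set1 x : measurable [set x].
Proof.
have -> : [set x] = \bigcap_(i in [set: 'I_d]) ((fun z => tnth z i) @^-1` [set tnth x i]).
  apply/seteqP; split => [z /= -> //|z /= h]; apply: eq_from_tnth => i; exact: h.
apply: fin_bigcap_measurable => // i _.
by rewrite -[X in measurable X]setTI; exact: (@measurable_tnth _ R d i).
Qed.

Lemma measurable_integral_bridge x y (t : R) : measurable_fun setT (fun z =>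
  \int[lebesgue_measure]_(s in `]0%R, t[) (gauss s x z * gauss (t - s)%R z y)%:E)%E.
Proof.
pose F (p : X) := (heatk 0 p (t, y) * heat_source x p)%:E.
have -> : (fun z => \int[lebesgue_measure]_(s in `]0%R, t[)
    (gauss s x z * gauss (t - s)%R z y)%:E)%E = fubini_G (@lebesgue_measure R) F.
  apply/funext => z; rewrite integral_mkcond; apply: eq_integral => s _.
  rewrite patchE /F /=; case: ifPn => [|/negP]; rewrite inE /= in_itv/=.
    move=> /andP[s0 st]; rewrite heat_source_gauss// /heatk /= st; congr EFin.
    by rewrite mul0r oppr0 expR0; ring.
  move/negP; rewrite negb_and -!leNgt => /orP[s0|ts].
    by rewrite /heat_source (heatk_eq0 _ _ (s, z))// mulr0.
  by rewrite (heatk_eq0 _ (s, z))// mul0r.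
apply: measurable_fun_fubini_tonelli_G => [|p]; last first.
  by rewrite lee_fin mulr_ge0 ?heatk_ge0.
by apply/measurable_EFinP; apply: measurable_funM; exact: measurable_heatk.
Qed.

(** For given [x] and [w], the endpoint [y = x + t w] makes the drift equal to [w]. Then
    [integral_bridge_ge] bounds the part of [KV] with [4 |z - x| ^ 2 <= t] uniformly in [t], and
    these sets exhaust the space as [t] grows. *)
Lemma KV_le_of_rpot V (c : R) : measurable_fun setT V -> 0 <= c ->
  (forall x (t : R) y, 0 < t ->
    (rpot 0%R (fun p : X => (`|V p.2| * heat_source x p)%R) (t, y) <= (c * gauss t x y)%:E)%E) ->
  exists M : R, forall x y, (KV V x y <= M%:E)%E.
Proof.
move=> mV c0 potle.
have [C C0 HC] := @integral_bridge_ge R d d3.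
exists (C * c) => x w.
have mnV : measurable_fun setT (fun z => `|V z|) by exact: (measurableT_comp _ mV).
have mK : measurable_fun setT (fun z => (`|V z| * Kker (subt z x) w)%:E).
  apply/measurable_EFinP; apply: measurable_funM => //; apply: measurable_Kker.
  exact: measurable_subt.
have K0 z : (0 <= (`|V z| * Kker (subt z x) w)%:E)%E by rewrite lee_fin mulr_ge0// Kker_ge0.
pose F (n : nat) := [set z | 4 * enorm (subt z x) ^+ 2 <= n.+1%:R].
have mF n : measurable (F n).
  have mf : measurable_fun setT (fun z : d.-tuple R => 4 * enorm (subt z x) ^+ 2 <= n.+1%:R).
    apply: measurable_fun_ler => //; apply: measurable_funM => //; apply: measurable_funX.
    by apply: measurable_enorm; exact: measurable_subt.
  have := mf measurableT [set true] Logic.I; rewrite setTI.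
  by rewrite (_ : _ @^-1` _ = F n)//; apply/seteqP; split.
have ndF : {homo F : n m / (n <= m)%N >-> (n <= m)%O}.
  move=> n m nm; apply/subsetPset => z; rewrite /F /= => /le_trans; apply.
  by rewrite ler_nat.
have UF : \bigcup_n F n = setT.
  apply/seteqP; split => // z _.
  exists (Num.truncn (4 * enorm (subt z x) ^+ 2)) => //.
  by rewrite /F /= ltW// truncnS_gt.
rewrite /KV -UF.
apply: (cvge_to_le (ge0_nondecreasing_set_cvg_integral (mu := lebesgue_tuple d)
  ndF mF (fun n => measurable_funTS mK) (fun n z _ => K0 z))).
apply: nearW => n; pose t : R := n.+1%:R; have t0 : 0 < t by rewrite ltr0n.
pose y : d.-tuple R := [tuple tnth x i + t * tnth w i | i < d].
have yw : scalt t^-1 (subt y x) = w.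
  apply: eq_from_tnth => i; rewrite !tnth_mktuple; field; by rewrite gt_eqF.
have g0 : 0 < gauss t x y by exact: gauss_gt0.
have Cg0 : 0 <= C / gauss t x y by rewrite divr_ge0// ltW.
pose I z := (\int[lebesgue_measure]_(s in `]0%R, t[) (gauss s x z * gauss (t - s)%R z y)%:E)%E.
have I0 z : (0 <= I z)%E.
  by apply: integral_ge0 => s _; rewrite lee_fin mulr_ge0 ?gauss_ge0.
have mI : measurable_fun setT I by exact: measurable_integral_bridge.
have mVI : measurable_fun setT (fun z => `|V z|%:E * I z)%E.
  by apply: emeasurable_funM => //; exact/measurable_EFinP.
have VI0 z : (0 <= `|V z|%:E * I z)%E by rewrite mule_ge0.
apply: (@le_trans _ _ (\int[lebesgue_tuple d]_(z in F n)
    ((C / gauss t x y)%:E * (`|V z|%:E * I z)))%E).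
  apply: ge0_le_integral => //.
  - exact: (measurable_funTS mK).
  - by apply: measurable_funTS; apply: emeasurable_funM.
  - move=> z Fz; rewrite muleCA EFinM lee_wpmul2l//.
    have := HC x y z t Fz t0; rewrite yw => h.
    have -> : (Kker (subt z x) w)%:E =
        ((gauss t x y)^-1%:E * (gauss t x y * Kker (subt z x) w)%:E)%E.
      by rewrite -EFinM mulKf// gt_eqF.
    rewrite [C / _]mulrC (EFinM (gauss t x y)^-1 C) -muleA.
    by rewrite lee_wpmul2l// lee_fin invr_ge0 ltW.
rewrite ge0_integralZl_EFin//; last exact: (measurable_funTS mVI).
have := potle x t y t0; rewrite rpot_heat_source// => h.
apply: (@le_trans _ _ ((C / gauss t x y)%:E * (c * gauss t x y)%:E)%E).
  rewrite lee_wpmul2l ?lee_fin//; apply: le_trans h.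
  by apply: ge0_subset_integral.
rewrite -EFinM lee_fin le_eqVlt; apply/orP; left; apply/eqP; field.
by rewrite gt_eqF.
Qed.

(** [integral_bridge_le] is integrated against [|V|]; its two K terms contribute [M] each. *)
Lemma rpot_le_of_KV V (M : R) : measurable_fun setT V ->
  (forall x y, (KV V x y <= M%:E)%E) -> exists2 c : R, 0 <= c &
  forall x (q : X),
    (rpot 0%R (fun p : X => (`|V p.2| * heat_source x p)%R) q <= (c * heat_source x q)%:E)%E.
Proof.
move=> mV KM.
have [C C0 HC] := @integral_bridge_le R d d3.
have M0 : 0 <= M.
  have x0 : d.-tuple R := [tuple 0 | i < d].
  rewrite -lee_fin; apply: le_trans (KM x0 x0); apply: integral_ge0 => z _.
  by rewrite lee_fin mulr_ge0// Kker_ge0.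
exists (C * (M + M)) => [|x [t y]]; first by rewrite mulr_ge0// addr_ge0.
have [t0|t0] := leP t 0.
  rewrite /heat_source heatk_eq0// mulr0 [X in (X <= _)%E]integral0_eq// => p _.
  have [p0|p0] := leP p.1 0; first by rewrite (heatk_eq0 0 ((0 : R), x) p p0) mulr0 mule0.
  by rewrite heatk_eq0 ?mul0e// (le_trans t0)// ltW.
rewrite rpot_heat_source// heat_source_gauss//.
have mnV : measurable_fun setT (fun z => `|V z|) by exact: (measurableT_comp _ mV).
have mK u w : measurable_fun setT (fun z => (`|V z| * Kker (subt z u) w)%:E).
  apply/measurable_EFinP; apply: measurable_funM => //; apply: measurable_Kker.
  exact: measurable_subt.
have K0 u w z : (0 <= (`|V z| * Kker (subt z u) w)%:E)%E by rewrite lee_fin mulr_ge0// Kker_ge0.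
have mI := measurable_integral_bridge x y t.
have I0 z : (0 <= \int[lebesgue_measure]_(s in `]0%R, t[)
    (gauss s x z * gauss (t - s)%R z y)%:E)%E.
  by apply: integral_ge0 => s _; rewrite lee_fin mulr_ge0 ?gauss_ge0.
have mVI : measurable_fun setT (fun z => `|V z|%:E * \int[lebesgue_measure]_(s in `]0%R, t[)
    (gauss s x z * gauss (t - s)%R z y)%:E)%E.
  by apply: emeasurable_funM => //; exact/measurable_EFinP.
(* The bridge bound needs [z] distinct from both endpoints, which form a null set. *)
pose N := [set x] `|` [set y].
have mN : measurable N by apply: measurableU; exact: measurable_tuple_set1.
have N0 : lebesgue_tuple d N = 0%E.
  apply/eqP; rewrite -measure_le0.
  suff : (lebesgue_tuple d [set x] + lebesgue_tuple d [set y] <= 0)%E.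
    apply: le_trans; exact: (measureU2 (lebesgue_tuple d) (measurable_tuple_set1 x)
      (measurable_tuple_set1 y)).
  by rewrite !lebesgue_tuple_set1 adde0.
rewrite (ge0_negligible_integral _ _ _ _ N0)//; last by move=> z _; rewrite mule_ge0.
pose A := C * gauss t x y; have A0 : 0 <= A by rewrite mulr_ge0// gauss_ge0.
pose Ka z := (`|V z| * Kker (subt z x) (scalt t^-1 (subt y x)))%:E.
pose Kb z := (`|V z| * Kker (subt z y) (scalt t^-1 (subt x y)))%:E.
have mKab : measurable_fun setT (fun z => A%:E * (Ka z + Kb z))%E.
  by apply: emeasurable_funM => //; apply: emeasurable_funD; exact: mK.
have Kab0 z : (0 <= A%:E * (Ka z + Kb z))%E by rewrite mule_ge0// adde_ge0 ?K0.
apply: (@le_trans _ _ (\int[lebesgue_tuple d]_(z in setT `\` N) (A%:E * (Ka z + Kb z)))%E).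
  apply: ge0_le_integral => //.
  - exact: measurableD.
  - by move=> z _; rewrite mule_ge0.
  - exact: (measurable_funTS mVI).
  - exact: (measurable_funTS mKab).
  move=> z [_ Nz].
  have zx : z <> x by move=> e; apply: Nz; left.
  have zy : z <> y by move=> e; apply: Nz; right.
  have := HC x y z t (enorm_subt_gt0 _ _ zx) (enorm_subt_gt0 _ _ zy) t0.
  move=> /(lee_wpmul2l (_ : (0 <= `|V z|%:E)%E)) => /(_ _)/le_trans; apply=> //.
  rewrite /Ka /Kb -EFinD -!EFinM lee_fin /A.
  have E (r g k1 k2 : R) : r * (C * g * (k1 + k2)) = C * g * (r * k1 + r * k2) by ring.
  by rewrite E.
apply: (@le_trans _ _ (\int[lebesgue_tuple d]_z (A%:E * (Ka z + Kb z)))%E).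
  by apply: ge0_subset_integral => //; exact: measurableD.
rewrite ge0_integralZl_EFin//; last 2 first.
- by move=> z _; rewrite adde_ge0 ?K0.
- by apply: emeasurable_funD; exact: mK.
rewrite ge0_integralD//; last 4 first.
- by move=> z _; exact: K0.
- exact: mK.
- by move=> z _; exact: K0.
- exact: mK.
have -> : C * (M + M) * gauss t x y = A * (M + M) by rewrite /A mulrAC.
rewrite (EFinM A) (EFinD M M); apply: lee_wpmul2l; first by rewrite lee_fin.
by apply: leeD; exact: KM.
Qed.

End boundedness.

Theorem corollary1p3 (R : realType) (d : nat) (hd : (3 <= d)%N)
    (V : d.-tuple R -> R) (mV : measurable_fun [set: d.-tuple R] V)
    (V_le0 : forall x, V x <= 0)
    (G : R -> d.-tuple R -> d.-tuple R -> R)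
    (hG : fundamental_solution V G) :
  (exists c1 c2 : R, [/\ 0 < c1, c1 <= 1, 1 <= c2 &
     forall (t : R) (x y : d.-tuple R), 0 < t ->
       c1 <= G t x y / gauss t x y <= c2]) <->
  (exists M : R, forall x y : d.-tuple R, (KV V x y <= M%:E)%E).
Proof.
pose v (p : measurableTypeR R * d.-tuple R) := `|V p.2|.
have v0 p : 0 <= v p by exact: normr_ge0.
have mv : measurable_fun setT v.
  by apply: (measurableT_comp (@normr_measurable R setT)); exact: (measurableT_comp mV).
have mvg x : measurable_fun setT (fun p => v p * heat_source x p).
  by apply: measurable_funM => //; exact: measurable_heat_source.
have vg0 x p : 0 <= v p * heat_source x p by rewrite mulr_ge0// heat_source_ge0.
have drop f : (forall p, 0 <= f p) ->
    ((fun p => v p * Num.max 0 (f p)) = (fun p => v p * f p)) /\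
    forall q, rpot 0 (fun p => v p * Num.max 0 (- f p)) q = 0%E.
  move=> f0; split => [|q]; first by apply/funext => p; rewrite max_r.
  by apply: integral0_eq => p _; rewrite max_l ?oppr_le0// mulr0 mule0.
split=> [[c1 [c2 [c10 _ _ Gg]]]|[M KM]].
  apply: (KV_le_of_rpot hd V c1^-1) => //; first by rewrite invr_ge0 ltW.
  move=> x t y t0.
  have [f fG [mf fneg finP finN fE]] := fundamental_solution_rpot V G x mV V_le0 hG.
  have gf p : c1 * heat_source x p <= f p.
    case: p => s z; have [s0|s0] := leP s 0.
      by rewrite fneg// /heat_source heatk_eq0// mulr0.
    rewrite fG// heat_source_gauss// -ler_pdivlMr ?gauss_gt0//.
    by have /andP[] := Gg s x z s0.
  have f0 p : 0 <= f p.
    by apply: le_trans (gf p); rewrite mulr_ge0 ?heat_source_ge0// ltW.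
  have [eP eN] := drop f f0; rewrite eP in finP fE.
  (* By [c1 * g <= f] and [f >= 0], [c1 * P(v g) <= P(v f) = g - f <= g]. *)
  rewrite -heat_source_gauss// EFinM lee_pdivlMl// -(rpotZ _ _ _ _ (ltW c10) (mvg x) (vg0 x)).
  apply: (@le_trans _ _ (rpot 0%R (fun p => (v p * f p)%R) (t, y))).
    apply: le_rpot => [||p|p _].
    - exact: measurable_funM.
    - exact: measurable_funM.
    - by rewrite mulr_ge0 ?(ltW c10)//; exact: vg0.
    - by rewrite mulrCA ler_wpM2l.
  by rewrite -(fineK (finP _)) lee_fin -subr_ge0; have := f0 (t, y); rewrite fE eN addr0.
have [c c0 potle] := rpot_le_of_KV hd V M mV KM.
(* The lower constant is that of [duhamel_lower] with [M = c]; the upper one is 1, since [f >= 0]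
   gives [f = g - P(v f) <= g]. *)
exists (expR (- (2 * c))), 1; split; rewrite ?expR_gt0//.
  by rewrite -[leRHS]expR0 ler_expR oppr_le0 mulr_ge0.
move=> t x y t0.
have [f fG [mf fneg finP finN fE]] := fundamental_solution_rpot V G x mV V_le0 hG.
have f0 : forall p, 0 <= f p.
  apply: (duhamel_ge0 v f (heat_source x)) => //.
  - exact: measurable_heat_source.
  - exact: heat_source_ge0.
  - by move=> l q; exact: heat_source_supermedian.
have [eP eN] := drop f f0; rewrite eP in finP fE.
have fE' q : f q = heat_source x q - fine (rpot 0 (fun p => v p * f p) q).
  by rewrite fE eN addr0.
have g0 : 0 < gauss t x y by exact: gauss_gt0.
rewrite -fG// ler_pdivlMr// ler_pdivrMr// mul1r -heat_source_gauss//.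
rewrite (duhamel_lower v f x c mv mf v0 f0 finP fE' (potle x))/=.
rewrite fE' gerBl fine_ge0// rpot_ge0// => p; exact: mulr_ge0.
Qed.
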